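(* Let $F$ be a non-archimedean local field. The normalized second eigenvalue $\lambda_{(r)}$ of the $r$-th sphere $S_r\subseteq\mathcal B_3=\mathcal B_3(F)$ around a vertex satisfies $$\lambda_{(r)}\ge\cos\left(\frac{2\pi}{r}\right)=1-\frac{2\pi^2}{r^2}+O\left(\frac1{r^4}\right).$$ In particular, $\lambda_{(r)}^r\to1$ as $r\to\infty$, so the $r$-power graphs of the $r$-spheres in $\mathcal B_3$ are not expanders (i.e. do not form a family of expanders).
   Context: Here $\pi$ in the formulas is the usual real number. Let $\mathcal O$ be the ring of integers of $F$ and $\varpi$ a uniformizer; the residue field is finite. The building $\mathcal B_3(F)$ is the 2-dimensional clique complex whose vertices are homothety classes of $\mathcal O$-lattices in $F^3$, two distinct classes being adjacent iff they have representatives $L,L'$ with $\varpi L<L'<L$. The $r$-sphere $S_r$ around a vertex $v_0$ is the subgraph of the one-skeleton induced on the vertices at graph distance exactly $r$ from $v_0$. With $A$ the adjacency operator of $S_r$ and $D$ its diagonal degree operator, $\lambda_{(r)}$ is the second largest eigenvalue of $D^{-1/2}AD^{-1/2}$. The $r$-power graph of $S_r$ is its $r$-th power as a graph (adjacency given by $r$-step walks on $S_r$), whose normalized eigenvalues are the $r$-th powers of those of $S_r$; a sequence of graphs is a family of expanders if the second largest normalized eigenvalues are bounded away from $1$.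
   Formalization: The inequality is stated for r ≥ 2, since at r = 1 it fails (λ_(1) = √q/(q+1) < 1 = cos 2π); the r-power graph carries r-step random-walk weights D(D⁻¹A)^r, so that its normalized eigenvalues are r-th powers although S_r is irregular. *)

(* Defs.v *)
From HB Require Import structures.
From mathcomp Require Import all_boot all_order all_algebra finmap.
From mathcomp Require Import all_classical all_reals all_analysis.

Set Implicit Arguments.
Unset Strict Implicit.
Unset Printing Implicit Defensive.

Import Order.TTheory GRing.Theory Num.Theory.
Import numFieldNormedType.Exports.

Local Open Scope classical_set_scope.
Local Open Scope ring_scope.

(* A valuation is a function [v : F -> int] that is only meaningful on nonzero
   elements; "x = 0 \/ k <= v x" plays the role of "k <= v x" with the
   convention v 0 = +oo. *)
Section Valuation.
Variables (F : fieldType) (v : F -> int).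

Definition val_ball (k : int) : set F := [set x | x = 0 \/ k <= v x].

Definition val_ring : set F := val_ball 0.

Definition is_uniformizer (w : F) : Prop := w != 0 /\ v w = 1.

Definition val_cauchy (u : nat -> F) : Prop :=
  forall k : int, exists N : nat, forall m n : nat,
    (N <= m)%N -> (N <= n)%N -> val_ball k (u m - u n).

Definition val_cvg (u : nat -> F) (l : F) : Prop :=
  forall k : int, exists N : nat, forall n : nat,
    (N <= n)%N -> val_ball k (u n - l).

(* Complete field for a normalized discrete valuation, with finite residue
   field: the maximal ideal is [val_ball 1], and the last clause says that
   finitely many classes modulo it cover the valuation ring. *)
Record nonarch_local_field : Prop := NonarchLocalField {
  val_mul : forall x y : F, x != 0 -> y != 0 -> v (x * y) = v x + v y;
  val_add : forall x y : F, x != 0 -> y != 0 -> x + y != 0 ->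
    Num.min (v x) (v y) <= v (x + y);
  val_uniformizer : exists w : F, is_uniformizer w;
  val_complete : forall u : nat -> F, val_cauchy u -> exists l : F, val_cvg u l;
  val_residue_finite : exists s : seq F,
    forall x : F, val_ring x -> exists2 y : F, y \in s & val_ball 1 (x - y)
}.

End Valuation.

Section Building.
Variables (F : fieldType) (v : F -> int).

Definition lattice_of (n : nat) (B : 'M[F]_n) : set 'rV[F]_n :=
  [set x | exists2 c : 'rV[F]_n, (forall i, val_ring v (c 0 i)) & x = c *m B].

Definition is_lattice (n : nat) (L : set 'rV[F]_n) : Prop :=
  exists2 B : 'M[F]_n, B \in unitmx & L = lattice_of B.

Definition scale_set (n : nat) (a : F) (L : set 'rV[F]_n) : set 'rV[F]_n :=
  [set a *: x | x in L].

Definition homothety_class (n : nat) (L : set 'rV[F]_n) :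
    set (set 'rV[F]_n) :=
  [set scale_set a L | a in [set a : F | a != 0]].

Definition building_vertex (n : nat) : set (set (set 'rV[F]_n)) :=
  [set X | exists2 L, is_lattice L & X = homothety_class L].

Definition building_adj (n : nat) (X Y : set (set 'rV[F]_n)) : Prop :=
  [/\ building_vertex X, building_vertex Y, X <> Y &
    exists w L L', [/\ is_uniformizer v w, X L, Y L',
      scale_set w L `<` L' & L' `<` L]].

End Building.

Section Graph.
Variables (T : Type) (e : T -> T -> Prop).

Fixpoint walk (n : nat) (x y : T) : Prop :=
  if n is m.+1 then exists2 z, e x z & walk m z y else x = y.

Definition at_distance (n : nat) (x y : T) : Prop :=
  walk n x y /\ forall m : nat, (m < n)%N -> ~ walk m x y.

Definition sphere (x : T) (r : nat) : set T := [set y | at_distance r x y].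

End Graph.

(* Adjacency matrix of the subgraph induced on the finite set S. *)
Definition adjmx (R : realType) (T : choiceType) (e : T -> T -> Prop)
    (S : set T) : 'M[R]_(size (fset_set S)) :=
  \matrix_(i, j) (`[< e (tnth (in_tuple (fset_set S)) i)
                        (tnth (in_tuple (fset_set S)) j) >])%:R.

(* A symmetric nonnegative matrix W is regarded as a weighted graph. *)
Section Spectrum.
Variables (R : realType) (n : nat).
Implicit Type W : 'M[R]_n.

Definition degree W (i : 'I_n) : R := \sum_j W i j.

Definition normalized_adjmx W : 'M[R]_n :=
  let D' := diag_mx (\row_i (Num.sqrt (degree W i))^-1) in D' *m W *m D'.

(* The graph of r-step walks of the random walk P = D^-1 W: the weight of
   {x, y} is deg x * P^r (x, y).  Degrees are those of W and the normalized
   adjacency matrix is the r-th power of the one of W.  The matrix W ^+ r would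
   not have that property when W is not regular. *)
Definition power_graph (r : nat) W : 'M[R]_n :=
  diag_mx (\row_i degree W i) *m
  (diag_mx (\row_i (degree W i)^-1) *m W) ^+ r.

(* Eigenvalues with multiplicity, in nonincreasing order; [::] when the
   characteristic polynomial does not split over R. *)
Definition spectrum (M : 'M[R]_n) : seq R :=
  xget [::] [set s : seq R | sorted >=%R s /\
                 char_poly M = \prod_(x <- s) ('X - x%:P)].

Definition second_eigenvalue (M : 'M[R]_n) : R := (spectrum M)`_1.

Definition lambda2 W : R := second_eigenvalue (normalized_adjmx W).

End Spectrum.

(* A sequence of finite (weighted) graphs, N k being the number of vertices. *)
Definition expander_family (R : realType) (N : nat -> nat)
    (W : forall k : nat, 'M[R]_(N k)) : Prop :=
  exists2 eps : R, 0 < eps & forall k : nat, lambda2 (W k) <= 1 - eps.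

Definition building_sphere (R : realType) (F : fieldType) (v : F -> int)
    (v0 : set (set 'rV[F]_3)) (r : nat) :=
  adjmx R (@building_adj F v 3) (sphere (@building_adj F v 3) v0 r).

(* Main.v *)
(* A vertex at distance r from v0 = [L0] is represented, in a suitable basis
   e0, e1, e2 of L0, by the lattice <e0, w^b e1, w^r e2> with 0 <= b <= r.  Its
   neighbours inside the sphere S_r have parameter b + 1 or b - 1, and for
   0 < b < r both kinds are parametrised by the residue field.  The simple
   random walk on S_r thus projects onto the reflected simple random walk on the
   path 0, ..., r, so that b |-> cos (pi b / r) lifts to an eigenfunction with
   eigenvalue cos (pi / r) < 1.  As 1 is an eigenvalue too, the second eigenvalue
   is at least cos (pi / r) >= cos (2 pi / r), and Bernoulli's inequality bounds
   its r-th power from below by 1 - pi^2 / (2 r). *)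

Require Import Defs.
From mathcomp Require Import all_boot all_order all_algebra finmap.
From mathcomp Require Import all_classical all_reals all_analysis.
From mathcomp Require Import ring lra zify.
From mathcomp Require Import perm complex.

Set Implicit Arguments.
Unset Strict Implicit.
Unset Printing Implicit Defensive.

Import Order.TTheory GRing.Theory Num.Theory.
Import numFieldNormedType.Exports.

Local Open Scope classical_set_scope.
Local Open Scope ring_scope.

(** * Spectra of symmetric matrices and weighted graphs *)

(** Neither the residue field nor the vertex degrees are ever counted. At an interior level the
    eigenvalue equation only asks that a vertex have as many neighbours above as below, and matching
    the neighbours that share a parameter t modulo w shows this. At the two ends only one kind of
    neighbour occurs, and the equation holds whatever its number.

    The main work is to show that the two parametrised families exhaust the neighbours inside the
    sphere. It rests on one invariant, the valuation of the determinant of a basis: an inclusion of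
    lattices with equal invariant is an equality, and in rank 3 a homothety moves it by a multiple
    of 3.

    For the power graphs the second eigenvalue is not identified with the r-th power of the one of
    the sphere, since negative eigenvalues may overtake it at even powers. Instead 1 and cos (pi /
    r)^r are exhibited as two distinct eigenvalues of the r-th power of the normalized matrix. *)

Section SymmetricSpectrum.
Variable R : realType.

(** Guarantees that [spectrum] is a genuine list of eigenvalues and not its default [[::]]. The
    roots are taken over the complex numbers and shown to be real. *)
Lemma symmetric_char_poly_split (n : nat) (M : 'M[R]_n) : M^T = M ->
  exists s : seq R, char_poly M = \prod_(x <- s) ('X - x%:P).
Proof.
move=> symM.
pose iota : {rmorphism R -> complex R} := real_complex R.
pose N := map_mx iota M.
have [s] := closed_field_poly_normal (char_poly N).
rewrite (monicP (char_poly_monic _)) scale1r => Ns.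
have real_s z : z \in s -> z = iota (complex.Re z).
  move=> zs.
  have : eigenvalue N z by rewrite eigenvalue_root_char Ns root_prod_XsubC.
  case/eigenvalueP => u uN u0.
  pose U := (map_mx Num.conj u)^T.
  have conjN : map_mx Num.conj N = N.
    apply/matrixP => i j; rewrite !mxE.
    by rewrite conj_Creal // complex_real.
  have normE : (u *m U) 0 0 = \sum_i `|u 0 i| ^+ 2.
    by rewrite mxE; apply: eq_bigr => i _; rewrite !mxE normCK.
  have norm_gt0 : 0 < (u *m U) 0 0.
    rewrite normE lt_def sumr_ge0 ?andbT; last by move=> i _; rewrite exprn_ge0.
    apply: contra u0 => /eqP /psumr_eq0P h; apply/eqP/rowP => i.
    rewrite [RHS]mxE; apply/eqP; rewrite -normr_eq0 -sqrf_eq0.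
    by rewrite h // => k _; rewrite exprn_ge0.
  (* The Hermitian form of a real symmetric matrix takes real values; at the eigenvector u it equals
     z times the positive real norm, so z is real. *)
  have q_real : ((u *m N *m U) 0 0)^* = (u *m N *m U) 0 0.
    have -> : ((u *m N *m U) 0 0)^* = (map_mx Num.conj (u *m N *m U))^T 0 0.
      by rewrite !mxE.
    have UE : (map_mx Num.conj U)^T = u.
      by apply/rowP => i; rewrite !mxE conjCK.
    have -> : ((map_mx Num.conj (u *m N *m U))^T) = u *m N *m U.
      have NT : N^T = N by rewrite /N map_trmx symM.
      by rewrite !map_mxM conjN !trmx_mul UE NT mulmxA.
    by [].
  have n_real : ((u *m U) 0 0)^* = (u *m U) 0 0 by rewrite conj_Creal ?gtr0_real.
  move: q_real; rewrite uN -scalemxAl mxE rmorphM /= n_real.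
  move=> /(mulIf (lt0r_neq0 norm_gt0)) zz.
  apply/esym/RRe_real; exact/CrealP.
exists (map (@complex.Re R) s).
apply: (map_poly_inj iota).
rewrite map_char_poly -/N Ns rmorph_prod big_map.
apply: eq_big_seq => z zs.
by rewrite rmorphB /= map_polyX map_polyC /= -/(iota _) -real_s.
Qed.

(** Two distinct eigenvalues make the sorted list have at least two entries, so index 1 is not the
    default of [nth]. The second conclusion serves for the upper bound by 1. *)
Lemma second_eigenvalue_ge (n : nat) (M : 'M[R]_n) (c d : R) : M^T = M ->
    eigenvalue M c -> eigenvalue M d -> c < d ->
  c <= second_eigenvalue M /\ eigenvalue M (second_eigenvalue M).
Proof.
move=> symM cM dM cd; rewrite /second_eigenvalue /spectrum.
set P := [set s | _]; have [] : P (xget [::] P).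
  apply: xgetPex; have [s Ms] := symmetric_char_poly_split symM.
  exists (sort >=%R s); split.
    by apply: sort_sorted => x y; exact: ge_total.
  by rewrite Ms; apply: perm_big; rewrite perm_sym perm_sort.
move: (xget _ _) => s s_sorted Ms.
have inS x : eigenvalue M x = (x \in s).
  by rewrite eigenvalue_root_char Ms root_prod_XsubC.
move: cM dM s_sorted; rewrite !inS {inS Ms P}; case: s => [//|x0 s] /=.
rewrite !inE path_sortedE; last exact: ge_trans.
move=> cs ds /andP[/allP le_x0 s_sorted].
(* If c headed the nonincreasing list, then d could not exceed it. *)
have {}cs : c \in s.
  case/predU1P: cs => // cx0; case/predU1P: ds => [dx0|/le_x0].
    by rewrite cx0 dx0 ltxx in cd.
  by rewrite -cx0 => /(lt_le_trans cd); rewrite ltxx.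
case: s cs s_sorted {le_x0 ds} => [//|x1 s] /=; rewrite !inE eqxx orbT.
rewrite path_sortedE; last exact: ge_trans.
by case/predU1P => [-> //|cs] /andP[/allP /(_ _ cs)].
Qed.

End SymmetricSpectrum.

(** * Normalized adjacency matrices of weighted graphs *)

Section WeightedGraph.
Variables (R : realType) (n : nat) (W : 'M[R]_n).
Hypothesis symW : W^T = W.
Hypothesis deg_gt0 : forall i, 0 < degree W i.

Let symWE i j : W i j = W j i.
Proof. by rewrite -[in LHS]symW mxE. Qed.

Lemma normalized_adjmxE i j : normalized_adjmx W i j =
  (Num.sqrt (degree W i))^-1 * W i j * (Num.sqrt (degree W j))^-1.
Proof. by rewrite /normalized_adjmx mul_mx_diag mxE mul_diag_mx !mxE. Qed.

Lemma normalized_adjmx_sym : (normalized_adjmx W)^T = normalized_adjmx W.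
Proof.
apply/matrixP => i j; rewrite mxE !normalized_adjmxE (symWE j) mulrAC.
by rewrite [RHS]mulrAC; congr (_ * _); exact: mulrC.
Qed.

Let sqrt_deg i : Num.sqrt (degree W i) != 0.
Proof. by rewrite gt_eqF // sqrtr_gt0. Qed.

Let sqr_sqrt_deg i : Num.sqrt (degree W i) * Num.sqrt (degree W i) = degree W i.
Proof. by rewrite -expr2 sqr_sqrtr // ltW. Qed.

(** The random walk D^-1 W and the normalized matrix are conjugate by D^(1/2), so an eigenfunction f
    of the former gives the eigenvector D^(1/2) f of the latter. *)
Lemma normalized_adjmx_eigenvalue (f : 'I_n -> R) (c : R) :
    (forall i, \sum_j W i j * f j = c * degree W i * f i) ->
    (exists i, f i != 0) ->
  eigenvalue (normalized_adjmx W) c.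
Proof.
move=> fE [i0 fi0]; apply/eigenvalueP.
exists (\row_i (Num.sqrt (degree W i) * f i)); last first.
  by apply: contraNneq fi0 => /rowP/(_ i0)/eqP; rewrite !mxE mulf_eq0 (negPf (sqrt_deg _)).
apply/rowP => j; rewrite !mxE.
transitivity ((\sum_i W j i * f i) * (Num.sqrt (degree W j))^-1).
  rewrite mulr_suml; apply: eq_bigr => i _; rewrite mxE normalized_adjmxE symWE.
  by field; rewrite !sqrt_deg.
rewrite fE -{1}[degree W j]sqr_sqrt_deg.
by field; rewrite sqrt_deg.
Qed.

(** The Dirichlet form, the sum of W i j (f i - f j)^2, is nonnegative; for f = D^(-1/2) u it equals
    2 (1 - x) times the squared norm of u. *)
Lemma normalized_adjmx_eigenvalue_le1 (x : R) : (forall i j, 0 <= W i j) ->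
  eigenvalue (normalized_adjmx W) x -> x <= 1.
Proof.
move=> W_ge0 /eigenvalueP[u uN u0].
pose f i := u 0 i / Num.sqrt (degree W i).
have uE i : u 0 i = f i * Num.sqrt (degree W i) by rewrite /f divfK.
have norm_gt0 : 0 < \sum_i u 0 i ^+ 2.
  rewrite lt_def sumr_ge0 ?andbT; last by move=> i _; rewrite sqr_ge0.
  apply: contra u0 => /eqP /psumr_eq0P h; apply/eqP/rowP => i.
  rewrite [RHS]mxE; apply/eqP; rewrite -sqrf_eq0.
  by rewrite h // => k _; rewrite sqr_ge0.
have E1 : \sum_i \sum_j W i j * f i ^+ 2 = \sum_i u 0 i ^+ 2.
  apply: eq_bigr => i _; rewrite -mulr_suml -/(degree W i) uE [RHS]exprMn.
  by rewrite sqr_sqrtr ?ltW // mulrC.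
have E2 : \sum_i \sum_j W i j * f j ^+ 2 = \sum_i u 0 i ^+ 2.
  by rewrite exchange_big -E1; apply: eq_bigr => i _; apply: eq_bigr => j _; rewrite symWE.
have E3 : \sum_i \sum_j W i j * (f i * f j) = x * \sum_i u 0 i ^+ 2.
  rewrite mulr_sumr exchange_big; apply: eq_bigr => j _.
  rewrite expr2 mulrA; have <- : (u *m normalized_adjmx W) 0 j = x * u 0 j.
    by rewrite uN mxE.
  rewrite mxE mulr_suml; apply: eq_bigr => i _; rewrite normalized_adjmxE /f; ring.
have : 0 <= \sum_i \sum_j W i j * (f i - f j) ^+ 2.
  by do 2![apply: sumr_ge0 => ? _]; rewrite mulr_ge0 ?sqr_ge0.
have -> : \sum_i \sum_j W i j * (f i - f j) ^+ 2 =
    2 * (1 - x) * \sum_i u 0 i ^+ 2.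
  transitivity (\sum_i \sum_j W i j * f i ^+ 2 + \sum_i \sum_j W i j * f j ^+ 2
      - 2 * \sum_i \sum_j W i j * (f i * f j)).
    rewrite mulr_sumr -sumrN -!big_split; apply: eq_bigr => i _ /=.
    rewrite mulr_sumr -sumrN -!big_split; apply: eq_bigr => j _ /=; ring.
  by rewrite E1 E2 E3; ring.
by rewrite pmulr_lge0 // pmulr_rge0 // subr_ge0.
Qed.

(** D^-1 W is stochastic: it fixes the all-ones column, and so do its powers. *)
Lemma degree_power_graph (r : nat) i : degree (power_graph r W) i = degree W i.
Proof.
have P1 : (diag_mx (\row_i (degree W i)^-1) *m W) *m const_mx 1 = const_mx 1 :> 'cV_n.
  apply/colP => k; rewrite mxE [RHS]mxE.
  under eq_bigr do rewrite mul_diag_mx !mxE mulr1.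
  by rewrite -mulr_sumr mulVf // gt_eqF.
have Pr1 : (diag_mx (\row_i (degree W i)^-1) *m W) ^+ r *m const_mx 1 =
    const_mx 1 :> 'cV_n.
  elim: r => [|r IH]; first by rewrite expr0 mul1mx.
  by rewrite exprS -mulmxA IH P1.
transitivity ((power_graph r W *m (const_mx 1 : 'cV_n)) i 0).
  by rewrite mxE; apply: eq_bigr => j _; rewrite [const_mx _ _ _]mxE mulr1.
by rewrite /power_graph -mulmxA Pr1 mul_diag_mx !mxE mulr1.
Qed.

Lemma normalized_adjmx_power_graph (r : nat) :
  normalized_adjmx (power_graph r W) = normalized_adjmx W ^+ r.
Proof.
rewrite /normalized_adjmx.
(* From here on [D] is the inverse square root of the degree matrix and [E] its inverse, so that the
   random walk is [D *m D *m W] and conjugation by [E] turns it into [D *m W *m D]. *)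
under eq_mx do rewrite degree_power_graph.
set D := diag_mx (\row_i (Num.sqrt _)^-1).
pose E := diag_mx (\row_i (Num.sqrt (degree W i))).
have DE : D *m E = 1%:M.
  by apply/matrixP => i j; rewrite mul_diag_mx !mxE mulrnAr mulVf ?sqrt_deg.
have ED : E *m D = 1%:M by rewrite (mulmx1C DE).
have EE : diag_mx (\row_i degree W i) = E *m E.
  by apply/matrixP => i j; rewrite mul_diag_mx !mxE mulrnAr sqr_sqrt_deg.
have DD : diag_mx (\row_i (degree W i)^-1) = D *m D.
  by apply/matrixP => i j; rewrite mul_diag_mx !mxE mulrnAr -invfM sqr_sqrt_deg.
rewrite /power_graph EE DD !mulmxA DE mul1mx.
elim: r => [|r IH]; first by rewrite !expr0 mulmx1.
by rewrite exprSr [RHS]exprSr -IH -!mulmxE !mulmxA.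
Qed.

End WeightedGraph.

Lemma eigenvalue_expmx (K : fieldType) (n : nat) (M : 'M[K]_n) (c : K) (r : nat) :
  eigenvalue M c -> eigenvalue (M ^+ r) (c ^+ r).
Proof.
case/eigenvalueP => u uM u0; apply/eigenvalueP; exists u => //.
elim: r => [|r IH]; first by rewrite !expr0 mulmx1 scale1r.
by rewrite exprSr mulmxA IH -scalemxAl uM scalerA -exprSr.
Qed.

Lemma trmx_exp (K : comNzRingType) (n : nat) (M : 'M[K]_n) (r : nat) :
  (M ^+ r)^T = M^T ^+ r.
Proof.
elim: r => [|r IH]; first by rewrite !expr0 trmx1.
by rewrite exprSr -mulmxE trmx_mul IH mulmxE -exprS.
Qed.

(** * Estimates for the cosine *)

Section CosineEstimates.
Variable R : realType.
Implicit Types x y : R.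

Lemma sin_mvt y : 0 < y -> exists2 c, 0 < c < y & sin y = y * cos c.
Proof.
move=> y0; have [|c] := @MVT R sin cos 0 y y0 (fun x _ => is_derive_sin x).
  exact/continuous_subspaceT/continuous_sin.
by rewrite in_itv /= sin0 !subr0 mulrC => cy siny; exists c.
Qed.

(** Reduces both bounds on cos to bounds on sin^2, for which a single use of the mean value theorem
    is enough. *)
Lemma cos_half x : cos x = 1 - 2 * sin (x / 2) ^+ 2.
Proof.
have {1}-> : x = (x / 2) *+ 2 by rewrite -mulr_natr; field.
by rewrite cos_mulr2n cos2sin2; ring.
Qed.

Lemma sin_sqr_le y : 0 <= y -> sin y ^+ 2 <= y ^+ 2.
Proof.
rewrite le_eqVlt => /predU1P[<-|y0]; first by rewrite sin0.
have [c _ ->] := sin_mvt y0; rewrite exprMn ler_piMr ?sqr_ge0 //.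
Qed.

Lemma cos_ge x : 0 <= x -> 1 - x ^+ 2 / 2 <= cos x.
Proof.
move=> x0; rewrite cos_half lerD2l lerN2.
by have := sin_sqr_le (divr_ge0 x0 (ler0n R 2)); lra.
Qed.

(** With y = x / 2 and sin y = y cos c, the bound cos c ^ 2 >= 1 - y^2 leaves an error of 2 y^4 =
    x^4 / 8. The constant is coarser than Taylor's 1/24, but any constant will do for the O-term. *)
Lemma cos_le x : 0 <= x -> cos x <= 1 - x ^+ 2 / 2 + x ^+ 4 / 8.
Proof.
rewrite le_eqVlt => /predU1P[<-|x0]; first by rewrite cos0 !expr0n /=; lra.
have y0 : 0 < x / 2 by rewrite divr_gt0.
have [c /andP[c0 cy] sE] := sin_mvt y0.
have cosc := cos_ge (ltW c0); have cosc1 := cos_le1 c.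
rewrite cos_half sE; set y := x / 2 in y0 cy *; have -> : x = 2 * y by rewrite /y; field.
have c2 : c ^+ 2 <= y ^+ 2 by rewrite ler_sqr ?nnegrE ?ltW.
(* A square being nonnegative, cos c ^ 2 >= 2 cos c - 1 >= 1 - c^2. *)
have cos2 : 1 - y ^+ 2 <= cos c ^+ 2.
  have : 0 <= (1 - cos c) * (1 - cos c) by rewrite mulr_ge0 // subr_ge0.
  nra.
have : y ^+ 2 * (1 - y ^+ 2) <= y ^+ 2 * cos c ^+ 2 by rewrite ler_wpM2l // sqr_ge0.
nra.
Qed.

Lemma bernoulli_ineq (t : R) (n : nat) : 0 <= t <= 1 -> 1 - n%:R * t <= (1 - t) ^+ n.
Proof.
case/andP => t0 t1; elim: n => [|n IH]; first by rewrite expr0 mul0r subr0.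
have tn : 0 <= n%:R * t ^+ 2 by rewrite mulr_ge0 // sqr_ge0.
have : (1 - t) * (1 - n%:R * t) <= (1 - t) * (1 - t) ^+ n.
  by rewrite ler_wpM2l // subr_ge0.
by rewrite exprS -natr1; apply: le_trans; nra.
Qed.

Lemma cos_expand_eqaddO :
  (fun r : nat => cos (2 * pi / r%:R) : R) =
    (fun r : nat => 1 - 2 * pi ^+ 2 / r%:R ^+ 2)
      +O_\oo (fun r : nat => (r%:R ^+ 4)^-1 : R).
Proof.
apply/eqaddOP; near=> K; near=> r => /=.
have r0 : 0 < r%:R :> R by rewrite ltr0n; near: r; exact: nbhs_infty_gt.
rewrite -[X in `|X| <= _]/(cos (2 * pi / r%:R) - (1 - 2 * pi ^+ 2 / r%:R ^+ 2)).
set x := 2 * pi / r%:R.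
have x0 : 0 <= x by rewrite divr_ge0 // ?mulr_ge0 ?pi_ge0 // ltW.
have xE : x ^+ 2 / 2 = 2 * pi ^+ 2 / r%:R ^+ 2 by rewrite /x; field; rewrite gt_eqF.
have x4E : x ^+ 4 / 8 = 2 * pi ^+ 4 * (r%:R ^+ 4)^-1 by rewrite /x; field; rewrite gt_eqF.
rewrite -xE.
have := cos_ge x0; have := cos_le x0 => lo hi.
rewrite ger0_norm; last by rewrite subr_ge0.
rewrite ger0_norm; last by rewrite invr_ge0 exprn_ge0 // ltW.
apply: (@le_trans _ _ (x ^+ 4 / 8)); first by rewrite lerBlDl.
rewrite x4E ler_wpM2r //.
Unshelve. all: by end_near. Qed.

(** Bernoulli's inequality with t = (pi / r)^2 / 2. It asks for t <= 1, which fails at r = 2 and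
    holds from r = 3 on, even with the crude bound pi <= 4. *)
Lemma cos_pi_exp_ge (r : nat) : (3 <= r)%N ->
  1 - pi ^+ 2 / 2 / r%:R <= cos (pi / r%:R) ^+ r :> R.
Proof.
move=> r3; have r0 : 0 < r%:R :> R by rewrite ltr0n (leq_trans _ r3).
have r3R : 3 <= r%:R :> R by rewrite ler_nat.
have pi0 := pi_ge0 R.
set x := pi / r%:R; have x0 : 0 <= x by rewrite divr_ge0 // ltW.
have pi4 : pi <= 4 :> R.
  by have := @pihalf_lt2 R; lra.
have x2 : x <= 4 / 3.
  by rewrite /x ler_pdivrMr //; nra.
have t1 : 0 <= x ^+ 2 / 2 <= 1.
  apply/andP; split; nra.
have -> : pi ^+ 2 / 2 / r%:R = r%:R * (x ^+ 2 / 2) by rewrite /x; field; rewrite gt_eqF.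
apply: (le_trans (bernoulli_ineq r t1)).
rewrite lerXn2r ?nnegrE ?cos_ge //; first by case/andP: t1; rewrite subr_ge0.
by apply: le_trans (cos_ge x0); case/andP: t1; rewrite subr_ge0.
Qed.

Lemma cos_pi_div_lt1 (r : nat) : (0 < r)%N -> cos (pi / r%:R) < 1 :> R.
Proof.
move=> r0; have rR : 0 < r%:R :> R by rewrite ltr0n.
have r1 : 1 <= r%:R :> R by rewrite ler1n.
have pi0 := pi_gt0 R.
have x0 : 0 < pi / r%:R :> R by rewrite divr_gt0.
have x1 : pi / r%:R <= pi :> R by rewrite ler_pdivrMr // ler_peMr // ltW.
by rewrite -[X in _ < X]cos0 ltr_cos ?in_itv /= ?lexx ?pi_ge0 ?x1 ?(ltW x0).
Qed.

Lemma cos_pi_div_ge0 (r : nat) : (2 <= r)%N -> 0 <= cos (pi / r%:R) :> R.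
Proof.
move=> r2; have r0 : 0 < r%:R :> R by rewrite ltr0n (leq_trans _ r2).
have r2R : 2 <= r%:R :> R by rewrite ler_nat.
have pi0 := pi_ge0 R.
have pir : 0 <= pi / r%:R :> R by rewrite divr_ge0 // ltW.
apply: cos_ge0_pihalf; apply/andP; split; first by lra.
by rewrite ler_pM2l ?pi_gt0 // lef_pV2 ?posrE.
Qed.

(** The three equations of the reflected walk on the path. The end equations hold because the cosine
    is even about 0 and about pi. *)
Lemma cos_path_rec (r b : nat) : (0 < r)%N ->
  let g k : R := cos (pi * k%:R / r%:R) in
  [/\ g 1%N = cos (pi / r%:R) * g 0%N,
      g r.-1 = cos (pi / r%:R) * g r &
      (0 < b)%N -> g b.+1 + g b.-1 = 2 * cos (pi / r%:R) * g b].
Proof.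
move=> r0 g; have rR : r%:R != 0 :> R by rewrite pnatr_eq0 -lt0n.
split.
- by rewrite /g mulr1 mulr0 mul0r cos0 mulr1.
- rewrite /g mulfK // cospi mulrN1 -[in RHS]cosN -cosDpi; congr cos.
  by rewrite -subn1 natrB //; field.
move=> b0; pose x : R := pi * b%:R / r%:R; pose y : R := pi / r%:R.
have -> : g b.+1 = cos (x + y) by congr cos; rewrite /x /y -natr1; field.
have -> : g b.-1 = cos (x - y) by congr cos; rewrite /x /y -subn1 natrB //; field.
by rewrite cosD cosB -/y -[g b]/(cos x); ring.
Qed.

End CosineEstimates.

(** Stated for a relation because the neighbours will be matched through a parameter that is unique
    only modulo the maximal ideal. *)
Lemma leq_card_rel (I : finType) (P Q : pred I) (rho : I -> I -> Prop) :
    (forall i, P i -> exists2 j, Q j & rho i j) ->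
    (forall i i' j, P i -> P i' -> rho i j -> rho i' j -> i = i') ->
  (#|P| <= #|Q|)%N.
Proof.
move=> ex inj.
have /fin_all_exists[f fP] i : exists j, P i -> Q j /\ rho i j.
  have [/ex[j Qj ij]|_] := boolP (P i); first by exists j.
  by exists i.
have f_inj : {in P &, injective f}.
  move=> i i' Pi Pi' ff; have [_ h] := fP i Pi; have [_ h'] := fP i' Pi'.
  by apply: (inj i i' (f i)) => //; rewrite ff.
rewrite -(card_in_imset f_inj); apply: subset_leq_card; apply/fintype.subsetP => j.
by case/imsetP => i Pi ->; have [] := fP i Pi.
Qed.

(** * Walks in a graph *)

Section Walks.
Variables (T : Type) (e : T -> T -> Prop).

Lemma walk_rcons n x y z : walk e n x y -> e y z -> walk e n.+1 x z.
Proof.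
elim: n x => [|n IH] x /=; first by move=> -> yz; exists z.
by case=> t xt ty yz; exists t => //; exact: IH.
Qed.

Lemma walk_finite (P : T -> Prop) n x :
    (forall x, P x -> finite_set [set y | e x y]) ->
    (forall x y, e x y -> P y) -> P x ->
  finite_set [set y | walk e n x y].
Proof.
move=> efin eP; elim: n x => [|n IH] x Px.
  apply: (sub_finite_set (B := [set x])); last exact: finite_set1.
  by move=> y /= ->.
apply: (sub_finite_set (B := \bigcup_(z in [set y | e x y]) [set y | walk e n z y])).
  by move=> y /= [z xz zy]; exists z.
by apply: bigcup_finite; [exact: efin | move=> z /= /eP; exact: IH].
Qed.

End Walks.

(** * Lattices over the valuation ring *)

Section Lattices.
Variables (F : fieldType) (v : F -> int).
Hypothesis hF : nonarch_local_field v.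
Variable w : F.
Hypothesis hw : is_uniformizer v w.

Definition vb (k : int) (x : F) : bool := (x == 0) || (k <= v x).

Lemma vbP k x : val_ball v k x <-> vb k x.
Proof.
by split=> [[->|kx]|/predU1P[->|kx]]; rewrite /vb ?eqxx ?kx ?orbT //; [left|right].
Qed.

Lemma w_neq0 : w != 0. Proof. by case: hw. Qed.

Lemma valM x y : x != 0 -> y != 0 -> v (x * y) = v x + v y.
Proof. exact: val_mul. Qed.

Lemma val1 : v 1 = 0.
Proof. by have := valM (oner_neq0 F) (oner_neq0 F); rewrite mulr1; move: (v 1) => a; lia. Qed.

Lemma valN1 : v (-1) = 0.
Proof.
have N0 : -1 != 0 :> F by rewrite oppr_eq0 oner_neq0.
by have := valM N0 N0; rewrite mulrNN mulr1 val1; lia.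
Qed.

Lemma valV x : x != 0 -> v x^-1 = - v x.
Proof.
by move=> x0; have := valM x0 (invr_neq0 x0); rewrite divff // val1; lia.
Qed.

Lemma val_wX k : v (w ^ k) = k.
Proof.
have X (n : nat) : v (w ^+ n) = n%:Z.
  elim: n => [|n IH]; first by rewrite expr0 val1.
  rewrite exprS valM ?w_neq0 ?expf_neq0 ?w_neq0 // IH.
  by case: hw => _ ->; lia.
by case: k => n; rewrite ?NegzE -?exprnP -?exprnN ?valV ?X ?expf_neq0 ?w_neq0.
Qed.

Lemma wX_neq0 k : w ^ k != 0. Proof. by rewrite expfz_neq0 // w_neq0. Qed.

Lemma vb0 k : vb k 0. Proof. by rewrite /vb eqxx. Qed.

Lemma vbE k x : x != 0 -> vb k x = (k <= v x).
Proof. by move=> /negPf x0; rewrite /vb x0. Qed.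

Lemma vb1 : vb 0 1. Proof. by rewrite vbE ?oner_neq0 // val1. Qed.

Lemma vbW j k x : j <= k -> vb k x -> vb j x.
Proof. by move=> jk /predU1P[->|kx]; rewrite /vb ?eqxx // (le_trans jk kx) orbT. Qed.

Lemma vbD k x y : vb k x -> vb k y -> vb k (x + y).
Proof.
move=> /predU1P[->|kx]; first by rewrite add0r.
move=> /predU1P[->|ky]; first by rewrite addr0 /vb kx orbT.
have [->|x0] := eqVneq x 0; first by rewrite add0r /vb ky orbT.
have [->|y0] := eqVneq y 0; first by rewrite addr0 /vb kx orbT.
have [->|xy0] := eqVneq (x + y) 0; first exact: vb0.
rewrite vbE //; apply: le_trans (val_add hF x0 y0 xy0).
by rewrite le_min kx.
Qed.

Lemma vbM j k x y : vb j x -> vb k y -> vb (j + k) (x * y).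
Proof.
have [->|x0] := eqVneq x 0; first by rewrite mul0r => _ _; exact: vb0.
have [->|y0] := eqVneq y 0; first by rewrite mulr0 => _ _; exact: vb0.
by rewrite !vbE ?mulf_neq0 // valM //; exact: lerD.
Qed.

Lemma vbN k x : vb k (- x) = vb k x.
Proof.
have imp y : vb k y -> vb k (- y).
  move=> ky; rewrite -mulN1r -[k]add0r; apply: vbM => //.
  by rewrite vbE ?oppr_eq0 ?oner_neq0 // valN1.
by apply/idP/idP => /imp; rewrite ?opprK.
Qed.

Lemma vbB k x y : vb k x -> vb k y -> vb k (x - y).
Proof. by move=> kx ky; apply: vbD; rewrite ?vbN. Qed.

Lemma vbMl k x y : vb 0 x -> vb k y -> vb k (x * y).
Proof. by move=> x0 ky; rewrite -[k]add0r; exact: vbM. Qed.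

Lemma vb_scale k a x : a != 0 -> vb k (a * x) = vb (k - v a) x.
Proof.
move=> a0; have [->|x0] := eqVneq x 0; first by rewrite mulr0 !vb0.
by rewrite !vbE ?mulf_neq0 // valM // lerBlDl.
Qed.

Lemma vb_sum (I : Type) (r : seq I) (P : pred I) (f : I -> F) k :
  (forall i, P i -> vb k (f i)) -> vb k (\sum_(i <- r | P i) f i).
Proof.
by move=> kf; elim/big_ind: _ => // [|x y]; [exact: vb0|exact: vbD].
Qed.

Lemma vb_prod (I : Type) (r : seq I) (P : pred I) (f : I -> F) :
  (forall i, P i -> vb 0 (f i)) -> vb 0 (\prod_(i <- r | P i) f i).
Proof.
by move=> kf; elim/big_ind: _ => // [|x y]; [exact: vb1|exact: vbMl].
Qed.

(** * Integral matrices and elementary divisors *)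

Definition imx m n (M : 'M[F]_(m, n)) : Prop := forall i j, vb 0 (M i j).

Lemma imx_mul m n p (M : 'M[F]_(m, n)) (N : 'M[F]_(n, p)) :
  imx M -> imx N -> imx (M *m N).
Proof.
by move=> iM iN i j; rewrite mxE; apply: vb_sum => k _; exact: vbMl.
Qed.

Lemma imx_det n (M : 'M[F]_n) : imx M -> vb 0 (\det M).
Proof.
move=> iM; apply: vb_sum => s _; apply: vbMl; last exact: vb_prod.
by rewrite -signr_odd; case: odd; rewrite ?expr1 ?vbN ?expr0 vb1.
Qed.

(** The group GL_n over the valuation ring. *)
Definition gl n (U : 'M[F]_n) : Prop := [/\ U \in unitmx, imx U & imx (invmx U)].

(** The inverse is the adjugate divided by a unit, and cofactors of an integral matrix are
    integral. *)
Lemma gl_det n (U : 'M[F]_n) : imx U -> \det U != 0 -> v (\det U) = 0 -> gl U.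
Proof.
move=> iU d0 vd; have uU : U \in unitmx by rewrite unitmxE unitfE.
split=> // i j; rewrite /invmx uU !mxE; apply: vbMl.
  by rewrite vbE ?invr_neq0 // valV // vd.
apply: vbMl; first by rewrite -signr_odd; case: odd; rewrite ?expr1 ?vbN ?expr0 vb1.
by apply: imx_det => k l; rewrite !mxE.
Qed.

Lemma val_det_gl n (U : 'M[F]_n) : gl U -> v (\det U) = 0.
Proof.
case=> uU iU iV; have d0 : \det U != 0 by rewrite -unitfE -unitmxE.
have /imx_det := iU; have /imx_det := iV.
rewrite det_inv !vbE ?invr_neq0 // valV //; move: (v _) => a. lia.
Qed.

Lemma gl_mul n (U V : 'M[F]_n) : gl U -> gl V -> gl (U *m V).
Proof.
move=> [uU iU iU'] [uV iV iV']; have uUV : U *m V \in unitmx by rewrite unitmx_mul uU.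
split=> //; first exact: imx_mul.
have -> : invmx (U *m V) = invmx V *m invmx U; last exact: imx_mul.
by rewrite -[RHS](mulKmx uUV) -!mulmxA (mulKVmx uV) mulmxV // mulmx1.
Qed.

Lemma gl_perm n (s : {perm 'I_n}) : gl (perm_mx s : 'M[F]_n).
Proof.
apply: gl_det.
- by move=> i j; rewrite !mxE; case: eqP; rewrite ?vb0 ?vb1.
- by rewrite det_perm signr_eq0.
- by rewrite det_perm; case: (odd_perm s); rewrite ?expr1 ?expr0 ?val1 ?valN1.
Qed.

Definition dmx n (d : 'I_n -> int) : 'M[F]_n := diag_mx (\row_i w ^ d i).

Lemma det_dmx n (d : 'I_n -> int) : \det (dmx d) = w ^ (\sum_i d i).
Proof.
rewrite det_diag; under eq_bigr do rewrite mxE.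
elim/big_ind2: _ => // x1 x2 y1 y2 -> ->.
by rewrite expfzDr ?w_neq0.
Qed.

Lemma dmx_unit n (d : 'I_n -> int) : dmx d \in unitmx.
Proof. by rewrite unitmxE unitfE det_dmx wX_neq0. Qed.

(* The pivot is an entry of least valuation, so that it divides all the other
   entries and the exponents come out in nondecreasing order. *)
Lemma smith n (A : 'M[F]_n) : A \in unitmx ->
  exists U V d, [/\ gl U, gl V, A = U *m dmx d *m V,
    forall i j : 'I_n, (i <= j)%N -> d i <= d j &
    forall k, (forall i j, vb k (A i j)) -> forall i, k <= d i].
Proof.
elim: n A => [|n IH] A uA.
  exists 1%:M, 1%:M, (fun=> 0); split; try by case.
  - by split; [exact: unitmx1|case|case].
  - by split; [exact: unitmx1|case|case].
  - by apply/matrixP; case.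
  - by move=> k _; case.
have [ij0 nz0] : exists ij, A ij.1 ij.2 != 0.
  apply/existsP; apply: contraLR uA => /existsPn A0.
  rewrite unitmxE unitfE negbK (expand_det_row A 0) big1 // => j _.
  by move/negPn/eqP: (A0 (0, j)) => /= ->; rewrite mul0r.
have [[i0 j0] /= a0 amin] := arg_minP (P := fun ij => A ij.1 ij.2 != 0)
  (fun ij => v (A ij.1 ij.2)) nz0.
set a := A i0 j0 in a0 amin.
have vbA i j : vb (v a) (A i j).
  have [->|ne0] := eqVneq (A i j) 0; first exact: vb0.
  by rewrite vbE // (amin (i, j)).
pose A1 : 'M[F]_(1 + n) := xrow 0 i0 (xcol 0 j0 A).
have vbA1 i j : vb (v a) (A1 i j) by rewrite !mxE.
pose u := ursubmx A1; pose l := dlsubmx A1.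
(* The Schur complement of the pivot. Its entries still have valuation at least that of a, which
   lets the induction continue with larger exponents. *)
pose A2 := drsubmx A1 - a^-1 *: (l *m u).
have A1ul : ulsubmx A1 = a%:M.
  apply/matrixP => i j; rewrite !ord1 !mxE eqxx mulr1n.
  have -> : lshift n 0 = 0 :> 'I_(1 + n) by exact/val_inj.
  by rewrite !tpermL.
pose L := block_mx 1%:M 0 (a^-1 *: l) 1%:M : 'M[F]_(1 + n).
pose V := block_mx 1%:M (a^-1 *: u) 0 1%:M : 'M[F]_(1 + n).
have A1E : A1 = L *m block_mx a%:M 0 0 A2 *m V.
  rewrite -[LHS]submxK A1ul !mulmx_block !mulmx0 !mul0mx !mul1mx !mulmx1.
  rewrite !addr0 !add0r -/u -/l mul_scalar_mx mul_mx_scalar !scalerA mulfV //.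
  by rewrite !scale1r -scalemxAr addrC subrK.
have ima m p (M : 'M[F]_(m, p)) : (forall i j, vb (v a) (M i j)) -> imx (a^-1 *: M).
  by move=> vM i j; rewrite mxE vb_scale ?invr_neq0 // valV // opprK add0r.
have imxI m p : imx (0 : 'M[F]_(m, p)) by move=> i j; rewrite mxE vb0.
have imx1 m : imx (1%:M : 'M[F]_m).
  by move=> i j; rewrite mxE; case: eqP; rewrite ?vb0 ?vb1.
have imxB m1 m2 p1 p2 (M1 : 'M[F]_(m1, p1)) (M2 : 'M[F]_(m1, p2)) (M3 : 'M[F]_(m2, p1))
    (M4 : 'M[F]_(m2, p2)) : imx M1 -> imx M2 -> imx M3 -> imx M4 ->
    imx (block_mx M1 M2 M3 M4).
  move=> h1 h2 h3 h4 i j.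
  rewrite -(fintype.splitK i) -(fintype.splitK j).
  by case: (fintype.split i) => ?; case: (fintype.split j) => ? /=;
    rewrite ?block_mxEul ?block_mxEur ?block_mxEdl ?block_mxEdr.
have glL : gl L.
  apply: gl_det; rewrite ?det_lblock ?det1 ?mulr1 ?val1 ?oner_neq0 //.
  by apply: imxB => //; apply: ima => i j; rewrite mxE; rewrite mxE vbA1.
have glV : gl V.
  apply: gl_det; rewrite ?det_ublock ?det1 ?mulr1 ?val1 ?oner_neq0 //.
  by apply: imxB => //; apply: ima => i j; rewrite mxE; rewrite mxE vbA1.
have uA1 : A1 \in unitmx.
  by rewrite /A1 xrowE xcolE !unitmx_mul !unitmx_perm uA.
have uA2 : A2 \in unitmx.
  by move: uA1; rewrite A1E !unitmx_mul block_diag_mx_unit => /andP[/andP[_ /andP[]]].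
have vbA2 i j : vb (v a) (A2 i j).
  rewrite /A2 mxE; apply: vbD; first by rewrite !mxE; exact: vbA.
  rewrite mxE vbN mxE vb_scale ?invr_neq0 // valV // opprK mxE.
  by apply: vb_sum => k _; apply: vbM; rewrite !mxE; exact: vbA.
have [U' [V' [d' [glU' glV' A2E mono_d' min_d']]]] := IH _ uA2.
(* The unit part of the pivot goes into the left factor, so that the diagonal consists of exact
   powers of w. *)
have vc : v (a / w ^ v a) = 0.
  by rewrite valM ?valV ?invr_neq0 ?wX_neq0 // val_wX subrr.
have c0 : a / w ^ v a != 0 by rewrite mulf_neq0 // invr_neq0 // wX_neq0.
have glB c (X : 'M[F]_n) : c != 0 -> v c = 0 -> gl X ->
    gl (block_mx c%:M 0 0 X : 'M[F]_(1 + n)).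
  move=> nzc c_0 glX; have [uX iX _] := glX.
  have detX : \det X != 0 by rewrite -unitfE -unitmxE.
  apply: gl_det; rewrite ?det_lblock ?det_scalar1 ?mulf_neq0 //.
    apply: imxB => // i j; rewrite mxE; case: eqP => _; rewrite ?vb0 //.
    by rewrite mulr1n vbE // c_0.
  by rewrite valM // c_0 val_det_gl.
pose d (i : 'I_(1 + n)) := if fintype.split i is inr j then d' j else v a.
have dE : dmx d = block_mx (w ^ v a)%:M 0 0 (dmx d').
  rewrite /dmx -diag_const_mx -diag_mx_row; congr diag_mx.
  apply/rowP => i; rewrite -(fintype.splitK i) mxE /d fintype.unsplitK.
  by case: (fintype.split i) => k /=; rewrite ?row_mxEl ?row_mxEr !mxE.
have tperm2 i j : tperm_mx i j *m tperm_mx i j = 1%:M :> 'M[F]_n.+1.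
  by rewrite -perm_mxM tperm2 perm_mx1.
have blockE : block_mx a%:M 0 0 A2 =
    block_mx (a / w ^ v a)%:M 0 0 U' *m dmx d *m block_mx 1%:M 0 0 V'.
  rewrite dE !mulmx_block !mulmx0 !mul0mx !addr0 !add0r.
  by rewrite !mul0mx mulmx1 -A2E -scalar_mxM divfK ?wX_neq0.
exists (tperm_mx 0 i0 *m (L *m block_mx (a / w ^ v a)%:M 0 0 U')).
exists (block_mx 1%:M 0 0 V' *m V *m tperm_mx 0 j0), d; split.
- by apply: gl_mul; [exact: gl_perm | apply: gl_mul => //; exact: glB].
- apply: gl_mul; last exact: gl_perm.
  by apply: gl_mul => //; apply: glB => //; rewrite ?oner_neq0 ?val1.
- have -> : A = tperm_mx 0 i0 *m A1 *m tperm_mx 0 j0.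
    by rewrite /A1 xrowE xcolE !mulmxA tperm2 mul1mx -mulmxA tperm2 mulmx1.
  by rewrite A1E blockE !mulmxA.
(* The lower bound on the exponents is part of the induction for the sake of this comparison of the
   new exponent with the later ones. *)
- have va_le j : v a <= d' j by exact: min_d'.
  move=> i j; rewrite -(@fintype.splitK 1 n i) -(@fintype.splitK 1 n j) /d.
  rewrite !fintype.unsplitK.
  case: (@fintype.split 1 n i) => i'; case: (@fintype.split 1 n j) => j' //=.
  - by rewrite (ord1 j').
  - by rewrite !add1n ltnS; exact: mono_d'.
move=> k kA i; have ka : k <= v a by rewrite -vbE //; exact: kA.
rewrite /d; case: (@fintype.split 1 n i) => // j; exact: le_trans ka (min_d' _ vbA2 j).
Qed.

(** * Lattices, inclusions and volumes *)

Notation lat := (lattice_of v).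

Lemma lat_mem n (B : 'M[F]_n) x : B \in unitmx ->
  lat B x <-> forall i, vb 0 ((x *m invmx B) 0 i).
Proof.
move=> uB; split=> [[c cint ->] i|xint]; first by rewrite mulmxK //; apply/vbP; exact: cint.
by exists (x *m invmx B); [move=> i; apply/vbP; exact: xint | rewrite mulmxKV].
Qed.

Lemma lat_sub n (A B : 'M[F]_n) : B \in unitmx ->
  lat A `<=` lat B <-> imx (A *m invmx B).
Proof.
move=> uB; split=> [AB i j|iM x [c cint ->]].
  have /AB : lat A (row i A).
    exists (delta_mx 0 i); last by rewrite rowE.
    move=> k; apply/vbP; rewrite mxE; case: andP => _; rewrite ?vb0 ?vb1 //.
  by case/(lat_mem _ uB)/(_ j); rewrite -row_mul mxE.
apply/lat_mem => // i; rewrite -mulmxA mxE.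
by apply: vb_sum => k _; apply: vbMl => //; apply/vbP; exact: cint.
Qed.

Lemma lat_gl n (U B : 'M[F]_n) : B \in unitmx -> gl U -> lat (U *m B) = lat B.
Proof.
move=> uB [uU iU iU']; apply/seteqP; split; apply/lat_sub => //.
- by rewrite mulmxK.
- by rewrite unitmx_mul uU.
have -> : B *m invmx (U *m B) = invmx U; last by [].
have uUB : U *m B \in unitmx by rewrite unitmx_mul uU.
by apply: (can_inj (mulmxK uUB)); rewrite mulmxKV // mulmxA mulVmx // mul1mx.
Qed.

(** The exponent of the covolume: the smaller the lattice, the larger [vol]. *)
Definition vol n (A : 'M[F]_n) : int := v (\det A).

Lemma det_neq0 n (A : 'M[F]_n) : A \in unitmx -> \det A != 0.
Proof. by rewrite unitmxE unitfE. Qed.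

Lemma volM n (A B : 'M[F]_n) : A \in unitmx -> B \in unitmx ->
  vol (A *m B) = vol A + vol B.
Proof. by move=> uA uB; rewrite /vol det_mulmx valM // det_neq0. Qed.

Lemma vol_dmx n (d : 'I_n -> int) (C : 'M[F]_n) : C \in unitmx ->
  vol (dmx d *m C) = \sum_i d i + vol C.
Proof.
by move=> uC; rewrite volM ?dmx_unit // /vol det_dmx val_wX.
Qed.

Lemma vol_scale n a (A : 'M[F]_n) : a != 0 -> A \in unitmx ->
  vol (a *: A) = n%:Z * v a + vol A.
Proof.
move=> a0 uA; rewrite /vol detZ valM ?expf_neq0 ?det_neq0 //; congr (_ + _).
elim: n {A uA} => [|n IH]; first by rewrite expr0 mul0r val1.
by rewrite exprS valM ?expf_neq0 // IH; move: (v a) => va; lia.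
Qed.

(** The transition matrix is integral with determinant of valuation 0, hence in [gl]. Thanks to
    this, equalities of lattices below need only one inclusion. *)
Lemma lat_volE n (A B : 'M[F]_n) : A \in unitmx -> B \in unitmx ->
  lat A `<=` lat B -> vol B = vol A -> lat A = lat B.
Proof.
move=> uA uB /(lat_sub _ uB) iM volE.
have uM : A *m invmx B \in unitmx by rewrite unitmx_mul uA unitmx_inv.
have AE : A = A *m invmx B *m B by rewrite mulmxKV.
rewrite AE; apply: lat_gl => //; apply: gl_det; rewrite ?det_neq0 //.
have := volM uM uB; rewrite -AE volE -[v _]/(vol (A *m invmx B)).
by move: (vol (_ *m _)) (vol A) => x y; lia.
Qed.

Lemma lat_eq_vol n (A B : 'M[F]_n) : A \in unitmx -> B \in unitmx ->
  lat A = lat B -> vol A = vol B.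
Proof.
move=> uA uB AB; have sub : lat A `<=` lat B by rewrite AB.
have sup : lat B `<=` lat A by rewrite AB.
have uM : A *m invmx B \in unitmx by rewrite unitmx_mul uA unitmx_inv.
have AE : A = A *m invmx B *m B by rewrite mulmxKV.
suff glM : gl (A *m invmx B) by rewrite AE volM // /vol val_det_gl // add0r.
split=> //; first exact/lat_sub.
have -> : invmx (A *m invmx B) = B *m invmx A; last exact/lat_sub.
by apply: (can_inj (mulmxK uM)); rewrite mulVmx // mulmxA mulmxKV // mulmxV.
Qed.

Lemma scale_lat n a (B : 'M[F]_n) : scale_set a (lat B) = lat (a *: B).
Proof.
apply/seteqP; split=> x.
  by move=> [_ [c cint ->] <-]; exists c => //; rewrite scalemxAr.
by move=> [c cint ->]; exists (c *m B); [exists c | rewrite scalemxAr].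
Qed.

Lemma scale_unit n a (A : 'M[F]_n) : a != 0 -> A \in unitmx -> a *: A \in unitmx.
Proof. by move=> a0 uA; rewrite unitmxZ // unitfE. Qed.

Lemma lat_subZ n a (A B : 'M[F]_n) : a != 0 -> B \in unitmx ->
  lat (a *: A) `<=` lat (a *: B) <-> lat A `<=` lat B.
Proof.
move=> a0 uB; rewrite !lat_sub ?scale_unit // invmxZ ?scale_unit //.
by rewrite -scalemxAl -scalemxAr scalerA divff // scale1r.
Qed.

Lemma lat_dmxP n (d : 'I_n -> int) (C : 'M[F]_n) c : C \in unitmx ->
  lat (dmx d *m C) (c *m C) <-> forall i, vb (d i) (c 0 i).
Proof.
move=> uC.
have dE b : b *m (dmx d *m C) = \row_i (b 0 i * w ^ d i) *m C.
  rewrite mulmxA; congr (_ *m _); apply/rowP => i.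
  by rewrite mul_mx_diag !mxE.
split=> [[b bint]|dc].
  rewrite dE => /(can_inj (mulmxK uC)) -> i; rewrite mxE mulrC vb_scale ?wX_neq0 //.
  by rewrite val_wX subrr; apply/vbP; exact: bint.
exists (\row_i (c 0 i / w ^ d i)).
  move=> i; apply/vbP; rewrite mxE mulrC vb_scale ?invr_neq0 ?wX_neq0 //.
  by rewrite valV ?wX_neq0 // val_wX opprK add0r.
rewrite dE; congr (_ *m _); apply/rowP => i.
by rewrite !mxE divfK // wX_neq0.
Qed.

Lemma latP n (C : 'M[F]_n) c : C \in unitmx ->
  lat C (c *m C) <-> forall i, vb 0 (c 0 i).
Proof.
move=> uC; have := lat_dmxP (fun=> 0) c uC.
suff -> : dmx (fun=> 0) = 1%:M :> 'M[F]_n by rewrite mul1mx.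
by apply/matrixP => i j; rewrite !mxE expr0z.
Qed.

Lemma lat_coord n (C : 'M[F]_n) x : C \in unitmx -> exists c : 'rV[F]_n, x = c *m C.
Proof. by move=> uC; exists (x *m invmx C); rewrite mulmxKV. Qed.

(** Write A B^-1 = U D V. Replacing B by V B does not change its lattice, and the left factor U does
    not change the lattice of A. *)
Lemma common_basis n (A B : 'M[F]_n) : A \in unitmx -> B \in unitmx ->
  exists C d, [/\ C \in unitmx, lat B = lat C, lat A = lat (dmx d *m C) &
    forall i j : 'I_n, (i <= j)%N -> d i <= d j].
Proof.
move=> uA uB.
have uM : A *m invmx B \in unitmx by rewrite unitmx_mul uA unitmx_inv.
have [U [V [d [glU glV ME mono_d _]]]] := smith uM.
have uV : V \in unitmx by case: glV.
exists (V *m B), d; split=> //; first by rewrite unitmx_mul uV.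
  by rewrite lat_gl.
by rewrite -[A](mulmxKV uB) ME -!mulmxA (lat_gl (U := U)) ?unitmx_mul ?dmx_unit ?uV ?uB.
Qed.

Lemma lat_dmx_sub n (d e : 'I_n -> int) (C : 'M[F]_n) : C \in unitmx ->
  lat (dmx d *m C) `<=` lat (dmx e *m C) <-> forall i, e i <= d i.
Proof.
move=> uC; split=> [sub i|ed x].
  have /sub/(lat_dmxP _ _ uC)/(_ i) : lat (dmx d *m C) ((w ^ d i *: delta_mx 0 i) *m C).
    apply/lat_dmxP => // j; rewrite !mxE eqxx /=; case: eqP => [->|_].
      by rewrite mulr1 vbE ?wX_neq0 // val_wX.
    by rewrite mulr0 vb0.
  by rewrite !mxE !eqxx mulr1 vbE ?wX_neq0 // val_wX.
have [c ->] := lat_coord x uC.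
move/(lat_dmxP _ _ uC) => dc; apply/lat_dmxP => // i.
exact: vbW (ed i) (dc i).
Qed.

Lemma dmx_scale n (d : 'I_n -> int) k : w ^ k *: dmx d = dmx (fun i => d i + k).
Proof.
apply/matrixP => i j; rewrite !mxE mulrnAr -expfzDr ?w_neq0 //.
by rewrite addrC.
Qed.

(** A scalar acts on lattices only through its valuation, so homothety classes are orbits under the
    powers of w. *)
Lemma lat_scale n a (A : 'M[F]_n) : a != 0 -> A \in unitmx ->
  lat (a *: A) = lat (w ^ v a *: A).
Proof.
move=> a0 uA; apply: lat_volE; rewrite ?scale_unit ?wX_neq0 //; last first.
  by rewrite !vol_scale ?wX_neq0 // val_wX.
apply/lat_sub; rewrite ?scale_unit ?wX_neq0 // invmxZ ?scale_unit ?wX_neq0 //.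
rewrite -scalemxAl -scalemxAr mulmxV // scalerA => i j; rewrite !mxE.
case: eqP => _; rewrite ?mulr0 ?vb0 // mulr1 vb_scale //.
by rewrite vbE ?invr_neq0 ?wX_neq0 // valV ?wX_neq0 // val_wX sub0r.
Qed.

(** * Homothety classes and adjacency *)

Definition cls n (A : 'M[F]_n) := homothety_class (lat A).

Lemma clsP n (A : 'M[F]_n) L : cls A L <-> exists2 a, a != 0 & L = lat (a *: A).
Proof.
split=> [[a a0 <-]|[a a0 ->]]; first by exists a => //; rewrite scale_lat.
by exists a => //; rewrite scale_lat.
Qed.

Lemma cls_eqP n (A B : 'M[F]_n) : A \in unitmx -> B \in unitmx ->
  cls A = cls B <-> exists k : int, lat A = lat (w ^ k *: B).
Proof.
move=> uA uB; split=> [AB|[k AB]].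
  have : cls B (lat A).
    by rewrite -AB; apply/clsP; exists 1; rewrite ?oner_neq0 // scale1r.
  by case/clsP => a a0 ->; exists (v a); rewrite lat_scale.
have E a : a != 0 -> lat (a *: A) = lat ((a * w ^ k) *: B).
  by move=> a0; rewrite -scalerA -!(scale_lat a) AB.
apply/seteqP; split=> L /clsP [a a0 ->]; apply/clsP.
  by exists (a * w ^ k); rewrite ?mulf_neq0 ?wX_neq0 // E.
exists (a / w ^ k); first by rewrite mulf_neq0 // invr_neq0 // wX_neq0.
by rewrite E ?mulf_neq0 ?invr_neq0 ?wX_neq0 // divfK // wX_neq0.
Qed.

Lemma vertexP n X : @building_vertex F v n X <-> exists2 A, A \in unitmx & X = cls A.
Proof.
split=> [[_ [A uA ->] ->]|[A uA ->]]; first by exists A.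
by exists (lat A) => //; exists A.
Qed.

Lemma cls_scale n a (A : 'M[F]_n) : a != 0 -> A \in unitmx -> cls (a *: A) = cls A.
Proof.
move=> a0 uA; apply/cls_eqP; rewrite ?scale_unit //.
by exists (v a); rewrite lat_scale.
Qed.

Lemma latD n (B : 'M[F]_n) x y : lat B x -> lat B y -> lat B (x + y).
Proof.
move=> [c ci ->] [d di ->]; exists (c + d); last by rewrite mulmxDl.
by move=> i; apply/vbP; rewrite mxE; apply: vbD; apply/vbP; [exact: ci | exact: di].
Qed.

Lemma latZ n (B : 'M[F]_n) t x : vb 0 t -> lat B x -> lat B (t *: x).
Proof.
move=> ti [c ci ->]; exists (t *: c); last by rewrite scalemxAl.
by move=> i; apply/vbP; rewrite mxE; apply: vbMl => //; apply/vbP; exact: ci.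
Qed.

Lemma latN n (B : 'M[F]_n) x : lat B x -> lat B (- x).
Proof. by move=> Bx; rewrite -scaleN1r; apply: latZ; rewrite ?vbN ?vb1. Qed.

Lemma latBK n (B : 'M[F]_n) x y : lat B y -> lat B (x - y) -> lat B x.
Proof. by move=> By /latD/(_ By); rewrite subrK. Qed.

Lemma lat_le_vol n (A B : 'M[F]_n) : A \in unitmx -> B \in unitmx ->
  lat A `<=` lat B -> vol B <= vol A.
Proof.
move=> uA uB /(lat_sub _ uB)/imx_det.
have uM : A *m invmx B \in unitmx by rewrite unitmx_mul uA unitmx_inv.
rewrite vbE ?det_neq0 // -[v _]/(vol (A *m invmx B)) => M_ge0.
by rewrite -[A](mulmxKV uB) volM // lerDr.
Qed.

Lemma lat_lt_vol n (A B : 'M[F]_n) : A \in unitmx -> B \in unitmx ->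
  lat A `<` lat B -> vol B < vol A.
Proof.
move=> uA uB [AB NBA]; rewrite lt_neqAle lat_le_vol // andbT.
by apply/eqP => volE; apply: NBA; rewrite (lat_volE uA uB AB volE).
Qed.

Lemma dmx_cst n k (C : 'M[F]_n) : w ^ k *: C = dmx (fun=> k) *m C.
Proof.
by rewrite -mul_scalar_mx; congr (_ *m _); apply/matrixP => i j; rewrite !mxE.
Qed.

Lemma lat_dmx_sub_cst n (d : 'I_n -> int) k (C : 'M[F]_n) : C \in unitmx ->
  lat (dmx d *m C) `<=` lat (w ^ k *: C) <-> forall i, k <= d i.
Proof. by move=> uC; rewrite dmx_cst; exact: lat_dmx_sub. Qed.

Lemma lat_cst_sub_dmx n (d : 'I_n -> int) k (C : 'M[F]_n) : C \in unitmx ->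
  lat (w ^ k *: C) `<=` lat (dmx d *m C) <-> forall i, d i <= k.
Proof. by move=> uC; rewrite dmx_cst; exact: lat_dmx_sub. Qed.

Lemma lat_eqZ n a (A B : 'M[F]_n) : lat A = lat B -> lat (a *: A) = lat (a *: B).
Proof. by move=> AB; rewrite -!scale_lat AB. Qed.

Lemma lat_eq_cls n (A B : 'M[F]_n) : lat A = lat B -> cls A = cls B.
Proof. by rewrite /cls => ->. Qed.

Lemma lat_ltZ n a (A B : 'M[F]_n) : a != 0 -> A \in unitmx -> B \in unitmx ->
  lat (a *: A) `<` lat (a *: B) <-> lat A `<` lat B.
Proof. by move=> a0 uA uB; split=> -[AB BA]; split; move: AB BA; rewrite !lat_subZ. Qed.

Local Notation adj := (@building_adj F v 3).

(** Adjacency allows any representatives and any uniformizer; rescaling fixes both, with the given A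
    as the larger lattice and the given w. *)
Lemma adjP (A : 'M[F]_3) Y : A \in unitmx ->
  adj (cls A) Y <-> exists B, [/\ B \in unitmx, Y = cls B,
    lat (w *: A) `<` lat B & lat B `<` lat A].
Proof.
move=> uA; split=> [[_ /vertexP[B uB ->] _ [w' [L [L' []]]]]|].
  move=> [w'0 vw'] /clsP[a a0 ->] /clsP[b b0 ->]; rewrite scale_lat => lt1 lt2.
  have uaA := scale_unit a0 uA; have ubB := scale_unit b0 uB.
  have aK : a *: (a^-1 *: (b *: B)) = b *: B by rewrite scalerA divff // scale1r.
  exists (a^-1 *: (b *: B)); rewrite !scale_unit ?invr_neq0 //.
  rewrite !cls_scale ?invr_neq0 //; split=> //.
    apply/(lat_ltZ a0); rewrite ?scale_unit ?invr_neq0 ?w_neq0 //.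
    rewrite aK.
    suff <- : lat (w' *: (a *: A)) = lat (a *: (w *: A)) by [].
    rewrite !scalerA lat_scale ?mulf_neq0 // [RHS]lat_scale ?mulf_neq0 ?w_neq0 //.
    by rewrite !valM ?w_neq0 // vw'; case: hw => _ ->; rewrite addrC.
  apply/(lat_ltZ a0); rewrite ?scale_unit ?invr_neq0 //.
  by rewrite aK.
move=> [B [uB -> lt1 lt2]].
have self (M : 'M[F]_3) : cls M (lat M).
  by apply/clsP; exists 1; rewrite ?oner_neq0 // scale1r.
split; [by apply/vertexP; exists A | by apply/vertexP; exists B | |].
  (* The volume of B lies strictly between vol A and vol A + 3, while homothetic lattices have
     volumes that differ by a multiple of 3. *)
  move/(cls_eqP uA uB) => [k] /lat_eq_vol; rewrite scale_unit ?wX_neq0 //.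
  move=> /(_ uA isT); rewrite vol_scale ?wX_neq0 // val_wX.
  have := lat_lt_vol uB uA lt2; have := lat_lt_vol (scale_unit w_neq0 uA) uB lt1.
  rewrite vol_scale ?w_neq0 //; case: hw => _ ->.
  by move: (vol A) (vol B) => x y; lia.
by exists w, (lat A), (lat B); rewrite scale_lat; split.
Qed.

(** From wA < B < A follows wB < wA < B. *)
Lemma adj_sym X Y : adj X Y -> adj Y X.
Proof.
move=> XY; have [/vertexP[A uA XE] _ _ _] := XY; move: XY; rewrite XE.
case/(adjP _ uA) => B [uB -> lt1 lt2]; apply/adjP => //.
exists (w *: A); rewrite scale_unit ?w_neq0 // cls_scale ?w_neq0 //; split => //.
by apply/lat_ltZ; rewrite ?w_neq0.
Qed.

Lemma adj_dmx (d e : 'I_3 -> int) (C : 'M[F]_3) : C \in unitmx ->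
    (forall i, d i <= e i <= d i + 1) ->
    (exists i, d i < e i) -> (exists i, e i < d i + 1) ->
  adj (cls (dmx d *m C)) (cls (dmx e *m C)).
Proof.
move=> uC de [i di] [j ej]; have uD f : dmx f *m C \in unitmx.
  by rewrite unitmx_mul dmx_unit.
apply/adjP => //; exists (dmx e *m C).
rewrite uD scalemxAl -[w]expr1z dmx_scale; split => //; split.
- by apply/lat_dmx_sub => // k; case/andP: (de k).
- by move/(lat_dmx_sub _ _ uC)/(_ j); rewrite leNgt ej.
- by apply/lat_dmx_sub => // k; case/andP: (de k).
- by move/(lat_dmx_sub _ _ uC)/(_ i); rewrite leNgt di.
Qed.

(** * Relative position of two vertices *)

Definition tri (a b c : int) (i : 'I_3) : int := nth 0 [:: a; b; c] i.
Definition o0 : 'I_3 := Ordinal (isT : (0 < 3)%N).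
Definition o1 : 'I_3 := Ordinal (isT : (1 < 3)%N).
Definition o2 : 'I_3 := Ordinal (isT : (2 < 3)%N).

Lemma ord3 (P : 'I_3 -> Prop) : P o0 -> P o1 -> P o2 -> forall i, P i.
Proof.
move=> P0 P1 P2 [[|[|[|//]]] i3].
- by rewrite (_ : Ordinal i3 = o0) //; exact: val_inj.
- by rewrite (_ : Ordinal i3 = o1) //; exact: val_inj.
- by rewrite (_ : Ordinal i3 = o2) //; exact: val_inj.
Qed.

Lemma sum_tri a b c : \sum_i tri a b c i = a + b + c.
Proof. by rewrite !big_ord_recr big_ord0 /= add0r. Qed.

Lemma tri_scale a b c k : w ^ k *: dmx (tri a b c) = dmx (tri (a + k) (b + k) (c + k)).
Proof. by rewrite dmx_scale; congr dmx; apply/funext; exact: ord3. Qed.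

(* [pos C0 r b X]: the elementary divisors of X relative to C0 are (r, b, 0). *)
Definition pos (C0 : 'M[F]_3) (r b : nat) X : Prop := exists C : 'M[F]_3,
  [/\ C \in unitmx, lat C = lat C0, X = cls (dmx (tri 0 b r) *m C) & (b <= r)%N].

Lemma pos_exists C0 X : C0 \in unitmx -> @building_vertex F v 3 X ->
  exists r b, pos C0 r b X.
Proof.
move=> uC0 /vertexP[A uA ->].
have [C [d [uC CC0 AE mono_d]]] := common_basis uA uC0.
have d01 : d o0 <= d o1 by exact: mono_d.
have d12 : d o1 <= d o2 by exact: mono_d.
exists `|d o2 - d o0|%N, `|d o1 - d o0|%N, C; split=> //; last by lia.
rewrite (lat_eq_cls AE) -[RHS](@cls_scale _ (w ^ d o0)) ?wX_neq0 //; last first.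
  by rewrite unitmx_mul dmx_unit.
rewrite scalemxAl tri_scale (_ : tri _ _ _ = d) //; apply/funext.
by apply: ord3; rewrite /tri /=; lia.
Qed.

(** A description of r and b without a basis: the two extremal multiples of C0 around B give j and r
    + j, and the volume then gives b. *)
Lemma pos_bounds C0 r b (B : 'M[F]_3) : C0 \in unitmx -> B \in unitmx ->
    pos C0 r b (cls B) ->
  exists j : int, [/\ forall m, lat B `<=` lat (w ^ m *: C0) <-> m <= j,
    forall m, lat (w ^ m *: C0) `<=` lat B <-> r%:Z + j <= m &
    vol B = vol C0 + 3%:Z * j + b%:Z + r%:Z].
Proof.
move=> uC0 uB [C [uC CC0 BE br]].
have uD d : dmx d *m C \in unitmx by rewrite unitmx_mul dmx_unit.
case/(cls_eqP uB (uD _)): BE => j BE; exists j.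
have volE := lat_eq_vol uB (scale_unit (wX_neq0 j) (uD _)) BE.
move: volE BE; rewrite vol_scale ?wX_neq0 // val_wX vol_dmx // sum_tri.
rewrite (lat_eq_vol uC uC0 CC0) scalemxAl tri_scale !add0r => volE ->.
split=> [m|m|].
- rewrite -(lat_eqZ _ CC0) lat_dmx_sub_cst //; split=> [/(_ o0) //|mj].
  by apply: ord3; rewrite /tri /=; lia.
- rewrite -(lat_eqZ _ CC0) lat_cst_sub_dmx //; split=> [/(_ o2) //|mj].
  by apply: ord3; rewrite /tri /=; lia.
by rewrite volE; move: (vol _) => x; lia.
Qed.

Lemma pos_uniq C0 r b r' b' X : C0 \in unitmx ->
  pos C0 r b X -> pos C0 r' b' X -> r = r' /\ b = b'.
Proof.
move=> uC0 p p'; have [C [uC _ XE _]] := p.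
have uB : dmx (tri 0 b r) *m C \in unitmx by rewrite unitmx_mul dmx_unit.
rewrite {}XE in p p'.
have [j [j1 j2 j3]] := pos_bounds uC0 uB p.
have [k [k1 k2 k3]] := pos_bounds uC0 uB p'.
have jk : j <= k by apply/k1/j1.
have kj : k <= j by apply/j1/k1.
have r1 : r%:Z + j <= r'%:Z + k by apply/j2/k2.
have r2 : r'%:Z + k <= r%:Z + j by apply/k2/j2.
by move: j3; rewrite k3; move: (vol C0) => x; lia.
Qed.

(** * Spheres in the building *)

Section Distance.
Variable C0 : 'M[F]_3.
Hypothesis uC0 : C0 \in unitmx.

(** What m steps from the class of [C0] guarantee: each step can be taken downwards, and loses at
    most one factor w. *)
Definition near (m : nat) X : Prop := exists A : 'M[F]_3,
  [/\ A \in unitmx, X = cls A, lat (w ^ m *: C0) `<=` lat A & lat A `<=` lat C0].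

Lemma walk_near m k X Y : walk adj m X Y -> near k X -> near (k + m) Y.
Proof.
elim: m k X => [|m IH] k X /=; first by move=> ->; rewrite addn0.
move=> [Z XZ ZY] [A [uA XE A1 A2]]; rewrite addnS -addSn; apply: (IH _ _ ZY).
move: XZ; rewrite XE => /(adjP _ uA) [B [uB -> [lt1 _] [lt2 _]]].
exists B; split=> //; last exact: subset_trans A2.
apply: subset_trans lt1; rewrite (_ : w ^ k.+1 = w * w ^ k); last by rewrite exprSz.
by rewrite -scalerA; apply/lat_subZ; rewrite ?w_neq0.
Qed.

(** The gap between the extremal multiples of C0 around any representative is exactly r, and [near]
    exhibits two multiples at gap m. *)
Lemma near_pos m r b X : near m X -> pos C0 r b X -> (r <= m)%N.
Proof.
move=> [A [uA -> A1 A2]] p; have [j [j1 j2 _]] := pos_bounds uC0 uA p.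
move/j2: A1; move: A2; rewrite -[C0]scale1r -(expr0z w) => /j1; lia.
Qed.

Lemma pos_walk r b X : pos C0 r b X -> walk adj r (cls C0) X.
Proof.
elim: r b X => [|r IH] b X [C [uC CC0 -> br]].
  rewrite leqn0 in br; rewrite (eqP br) /= -(lat_eq_cls CC0).
  apply: lat_eq_cls; rewrite -[in LHS](mul1mx C); congr (lat (_ *m _)).
  apply/matrixP => i j; rewrite !mxE; congr (_ *+ _).
  by elim/ord3: i; rewrite /tri /= expr0z.
(* The predecessor lowers the last exponent, and the middle one too when b = r + 1, so that the
   exponents stay ordered. *)
apply: (@walk_rcons _ _ _ _ (cls (dmx (tri 0 (minn b r) r) *m C))).
  by apply: (IH (minn b r)); exists C; split=> //; exact: geq_minr.
have uD d : dmx d *m C \in unitmx by rewrite unitmx_mul dmx_unit.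
apply: adj_sym; rewrite -[cls (dmx (tri 0 (minn b r) r) *m C)](@cls_scale _ w) ?w_neq0 //.
rewrite scalemxAl -[w]expr1z tri_scale; apply: adj_dmx => //.
- by apply: ord3; rewrite /tri /=; lia.
- by exists o0.
- by exists o2; rewrite /tri /=; lia.
Qed.

(** [pos_walk] gives a walk of length r and [near_pos] excludes shorter ones. Conversely every
    vertex has some position, whose first parameter must then be its distance. *)
Lemma at_distanceP r X : at_distance adj r (cls C0) X <-> exists b, pos C0 r b X.
Proof.
have near0 : near 0 (cls C0).
  by exists C0; split=> //; rewrite expr0z scale1r.
have dist k b Y : pos C0 k b Y -> at_distance adj k (cls C0) Y.
  move=> p; split; first exact: pos_walk p.
  by move=> m mk /walk_near/(_ near0); rewrite add0n => /near_pos/(_ p); rewrite leqNgt mk.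
split=> [|[b]]; last exact: dist.
move=> [rX minr]; have vX : @building_vertex F v 3 X.
  have : near r X by rewrite -[r]add0n; exact: walk_near near0.
  by case=> A [uA -> _ _]; apply/vertexP; exists A.
have [k [b p]] := pos_exists uC0 vX; have [kX mink] := dist _ _ _ p.
case: (ltngtP k r) => [/minr//|/mink//|<-]; by exists b.
Qed.

End Distance.

(** A lattice B between wA and A is a union of cosets of wA, hence determined by which of finitely
    many coset representatives it contains. *)
Lemma adj_finite X : @building_vertex F v 3 X -> finite_set [set Y | adj X Y].
Proof.
move=> /vertexP[A uA ->].
have [s sP] := val_residue_finite hF.
pose el (g : {ffun 'I_3 -> 'I_(size s)}) := (\row_i s`_(g i)) *m A.
pose f (S : {set {ffun 'I_3 -> 'I_(size s)}}) :=
  homothety_class [set x | exists2 g, g \in S & lat (w *: A) (x - el g)].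
apply: (sub_finite_set (B := f @` setT)); last exact/finite_image/finite_finset.
move=> Y /= /(adjP _ uA) [B [uB -> [lt1 _] [lt2 _]]].
exists [set g | `[< lat B (el g) >]]%SET => //.
rewrite /f /cls; congr homothety_class; apply/seteqP; split=> x /=.
  case=> g; rewrite inE => /asboolP Bg /lt1; exact: latBK.
move=> Bx; have [c xE] := lat_coord x uA.
have /(latP _ uA) ci : lat A (c *m A) by rewrite -xE; exact: lt2.
have /fin_all_exists[g gP] i : exists k : 'I_(size s), vb 1 (c 0 i - s`_k).
  have [y ys cy] := sP (c 0 i) (iffRL (vbP _ _) (ci i)).
  have ys' : (index y s < size s)%N by rewrite index_mem.
  by exists (Ordinal ys'); rewrite /= nth_index //; exact/vbP.
have cg : lat (w *: A) (x - el [ffun i => g i]).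
  rewrite xE /el -mulmxBl -[w]expr1z dmx_cst; apply/lat_dmxP => // i.
  by rewrite !mxE ffunE.
exists [ffun i => g i] => //; rewrite inE; apply/asboolP.
by rewrite -[el _](subKr x); apply: latD => //; apply: latN; exact: lt1.
Qed.

(** Needed for [fset_set] to enumerate the sphere, since its value on an infinite set is empty. *)
Lemma sphere_finite C0 r : C0 \in unitmx -> finite_set (sphere adj (cls C0) r).
Proof.
move=> uC0; apply: (sub_finite_set (B := [set Y | walk adj r (cls C0) Y])).
  by move=> Y [].
apply: (walk_finite (P := @building_vertex F v 3)); first exact: adj_finite.
  by move=> X Y [].
by apply/vertexP; exists C0.
Qed.

(** The inclusions confine the exponents to 0 and 1, and strictness forces the first to be 0 and the
    last to be 1. The middle one tells whether B / wA is a plane ([false]) or a line ([true]). *)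
Lemma adj_basis (A B : 'M[F]_3) : A \in unitmx -> B \in unitmx ->
    lat (w *: A) `<` lat B -> lat B `<` lat A ->
  exists C (e : bool), [/\ C \in unitmx, lat A = lat C &
    lat B = lat (dmx (tri 0 (e : nat) 1) *m C)].
Proof.
move=> uA uB [lt1 nle1] [lt2 nle2].
have [C [d [uC AC BE mono_d]]] := common_basis uB uA.
have d01 : d o0 <= d o1 by exact: mono_d.
have d12 : d o1 <= d o2 by exact: mono_d.
have d_ge0 i : 0 <= d i.
  have : lat (dmx d *m C) `<=` lat (w ^ 0 *: C) by rewrite -BE expr0z scale1r -AC.
  by move/(lat_dmx_sub_cst _ _ uC)/(_ i).
have d_le1 i : d i <= 1.
  have : lat (w ^ 1 *: C) `<=` lat (dmx d *m C).
    by rewrite -BE expr1z -(lat_eqZ w AC).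
  by move/(lat_cst_sub_dmx _ _ uC)/(_ i).
have d2 : 0 < d o2.
  rewrite ltNge; apply/negP => d2; apply: nle2.
  rewrite AC BE -[X in lat X `<=` _]scale1r -(expr0z w).
  by apply/lat_cst_sub_dmx => //; apply: ord3; lia.
have d0 : d o0 < 1.
  rewrite ltNge; apply/negP => d0; apply: nle1.
  rewrite (lat_eqZ w AC) BE -[X in X *: C](expr1z w).
  by apply/lat_dmx_sub_cst => //; apply: ord3; lia.
have h0 := d_ge0 o0; have h1 := d_ge0 o1; have h2 := d_le1 o2; have h3 := d_le1 o1.
exists C, (d o1 == 1); split=> //; rewrite BE (_ : tri _ _ _ = d) //.
apply/funext; apply: ord3; rewrite /tri /=; [lia | | lia].
by case: (d o1 =P 1) => /=; lia.
Qed.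

(* B / wC is a line in C / wC. *)
Lemma line_span (B C : 'M[F]_3) z x : C \in unitmx ->
    lat B = lat (dmx (tri 0 1 1) *m C) -> lat B z -> ~ lat (w *: C) z ->
  lat B x -> exists2 t, vb 0 t & lat (w *: C) (x - t *: z).
Proof.
move=> uC ->; have [c ->] := lat_coord z uC; have [c' ->] := lat_coord x uC.
rewrite -[w in w *: C]expr1z dmx_cst => /(lat_dmxP _ _ uC) hc nc /(lat_dmxP _ _ uC) hc'.
have c0 : ~~ vb 1 (c 0 o0).
  apply/negP => c0; apply: nc; apply/lat_dmxP => //; apply: ord3 => //.
    exact: (hc o1).
  exact: (hc o2).
have nz : c 0 o0 != 0 by apply: contra c0 => /eqP ->; rewrite vb0.
have vc0 : v (c 0 o0) = 0.
  by have := hc o0; move: c0; rewrite !vbE // /tri /=; move: (v _) => y; lia.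
have vt : vb 0 (c' 0 o0 / c 0 o0).
  by rewrite mulrC vb_scale ?invr_neq0 // valV // vc0; exact: (hc' o0).
exists (c' 0 o0 / c 0 o0) => //.
rewrite scalemxAl -mulmxBl; apply/lat_dmxP => //; apply: ord3; rewrite !mxE.
- by rewrite divfK // subrr vb0.
- by apply: vbB; [exact: (hc' o1) | apply: vbMl => //; exact: (hc o1)].
- by apply: vbB; [exact: (hc' o2) | apply: vbMl => //; exact: (hc o2)].
Qed.

(* B / wC is a plane in C / wC. *)
Lemma plane_span (B C : 'M[F]_3) z x : C \in unitmx ->
    lat B = lat (dmx (tri 0 0 1) *m C) -> lat C z -> ~ lat B z ->
  lat C x -> exists2 t, vb 0 t & lat B (x - t *: z).
Proof.
move=> uC ->; have [c ->] := lat_coord z uC; have [c' ->] := lat_coord x uC.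
move=> /(latP _ uC) hc nc /(latP _ uC) hc'.
have c2 : ~~ vb 1 (c 0 o2).
  by apply/negP => c2; apply: nc; apply/lat_dmxP => //; exact: ord3.
have nz : c 0 o2 != 0 by apply: contra c2 => /eqP ->; rewrite vb0.
have vc2 : v (c 0 o2) = 0.
  by have := hc o2; move: c2; rewrite !vbE // /tri /=; move: (v _) => y; lia.
have vt : vb 0 (c' 0 o2 / c 0 o2).
  by rewrite mulrC vb_scale ?invr_neq0 // valV // vc2; exact: (hc' o2).
exists (c' 0 o2 / c 0 o2) => //.
rewrite scalemxAl -mulmxBl; apply/lat_dmxP => //; apply: ord3; rewrite !mxE.
- by apply: vbB => //; exact: vbMl.
- by apply: vbB => //; exact: vbMl.
- by rewrite divfK // subrr vb0.
Qed.

(** * Elementary transformations of a basis *)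

Section Elementary.
Variables (C : 'M[F]_3) (i j : 'I_3).
Hypothesis uC : C \in unitmx.
Hypothesis ij : i != j.

(** The basis in which the row e_i is replaced by e_i + s e_j. *)
Definition elem (s : F) : 'M[F]_3 := (1%:M + s *: delta_mx i j) *m C.

Lemma elem_mul s t :
  (1%:M + s *: delta_mx i j) *m (1%:M + t *: delta_mx i j) =
  1%:M + (s + t) *: delta_mx i j :> 'M[F]_3.
Proof.
rewrite mulmxDl mul1mx mulmxDr mulmx1 -scalemxAl -scalemxAr mul_delta_mx_0 1?eq_sym //.
by rewrite !scaler0 addr0 -addrA -scalerDl [t + s]addrC.
Qed.

Lemma elem_unit s : elem s \in unitmx.
Proof.
rewrite unitmx_mul uC andbT; have := elem_mul s (- s).
by rewrite subrr scale0r addr0 => /mulmx1_unit[].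
Qed.

Lemma elem_coord s c : c *m C = (\row_k (c 0 k - (k == j)%:R * (s * c 0 i))) *m elem s.
Proof.
rewrite /elem mulmxA; congr (_ *m _); rewrite mulmxDr mulmx1 -scalemxAr.
apply/rowP => k; rewrite !mxE (bigD1 i) //= big1 => [|l li]; last first.
  by rewrite !mxE (negPf li) mulr0.
rewrite !mxE eqxx (negPf ij) mul0r subr0 addr0 /=.
by case: (k == j); rewrite ?mulr1 ?mul1r ?mulr0 ?mul0r ?subr0 ?addr0 // mulrC; ring.
Qed.

(** Membership is tested in the coordinates of the fixed basis [C], so that lattices for different s
    can be compared. *)
Lemma lat_elemP d s c : lat (dmx d *m elem s) (c *m C) <->
  forall k, vb (d k) (c 0 k - (k == j)%:R * (s * c 0 i)).
Proof.
rewrite (elem_coord s) lat_dmxP ?elem_unit //.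
by split=> h k; move: (h k); rewrite mxE.
Qed.

Lemma elem0 : elem 0 = C. Proof. by rewrite /elem scale0r addr0 mul1mx. Qed.

Lemma lat_elem_eqP d s s' :
  lat (dmx d *m elem s) = lat (dmx d *m elem s') <-> vb (d j - d i) (s - s').
Proof.
have sub a a' : vb (d j - d i) (a - a') ->
    lat (dmx d *m elem a) `<=` lat (dmx d *m elem a').
  move=> aa' x; have [c ->] := lat_coord x uC => /lat_elemP h; apply/lat_elemP => k.
  have [kj|kj] := eqVneq k j; last by have := h k; rewrite (negPf kj) !mul0r.
  have := h k; rewrite kj eqxx !mul1r => hj.
  rewrite (_ : _ - _ = c 0 j - a * c 0 i + (a - a') * c 0 i); last by ring.
  apply: vbD => //; rewrite -(subrK (d i) (d j)); apply: vbM => //.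
  by have := h i; rewrite (negPf ij) mul0r subr0.
split=> [E|h]; last first.
  by apply/seteqP; split; apply: sub => //; rewrite -(opprB s) vbN.
(* The generator w^(d i) (e_i + s e_j) is the test vector: it lies in the second lattice only if s
   and s' agree modulo w^(d j - d i). *)
have : lat (dmx d *m elem s) ((w ^ d i *: (delta_mx 0 i + s *: delta_mx 0 j)) *m C).
  apply/lat_elemP => k; rewrite !mxE !eqxx (negPf ij) mulr0 addr0 mulr1 /=.
  have [->|ki] := eqVneq k i.
    by rewrite (negPf ij) mulr0 addr0 mul0r subr0 mulr1 vbE ?wX_neq0 // val_wX.
  case: (k == j); last by rewrite !mulr0 addr0 mulr0 mul0r subr0 vb0.
  by rewrite add0r mulr1 mul1r mulrC subrr vb0.
rewrite E => /lat_elemP/(_ j); rewrite !mxE !eqxx (negPf ij) eq_sym (negPf ij) /=.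
rewrite mulr0 addr0 add0r !mulr1 mul1r (mulrC s') -mulrBr vb_scale ?wX_neq0 //.
by rewrite val_wX.
Qed.

Lemma lat_elem s : vb 0 s -> lat (elem s) = lat C.
Proof.
move=> s0; rewrite -[in RHS]elem0 -[elem s]scale1r -[elem 0]scale1r -(expr0z w).
by rewrite !dmx_cst; apply/lat_elem_eqP; rewrite !subr0.
Qed.

(** For integral s all these lattices have the same volume, so they are homothetic only when
    equal. *)
Lemma cls_elem_eqP d s s' : vb 0 s -> vb 0 s' ->
  cls (dmx d *m elem s) = cls (dmx d *m elem s') <-> vb (d j - d i) (s - s').
Proof.
move=> s0 s'0; rewrite -lat_elem_eqP; split=> [|E]; last exact: lat_eq_cls.
have uD a : dmx d *m elem a \in unitmx by rewrite unitmx_mul dmx_unit elem_unit.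
move/(cls_eqP (uD s) (uD s')) => [k E].
have := lat_eq_vol (uD s) (scale_unit (wX_neq0 k) (uD s')) E.
rewrite vol_scale ?wX_neq0 // val_wX !vol_dmx ?elem_unit //.
rewrite !(lat_eq_vol (elem_unit _) uC (lat_elem _)) // => volE.
have k0 : k = 0 by move: volE; move: (_ + vol C) => y; lia.
by rewrite E k0 expr0z scale1r.
Qed.

End Elementary.

(** * Neighbours within a sphere *)

Section Neighbours.
Variables (C0 C : 'M[F]_3) (r b : nat).
Hypotheses (uC0 : C0 \in unitmx) (uC : C \in unitmx) (CC0 : lat C = lat C0).
Hypotheses (r_gt0 : (0 < r)%N) (br : (b <= r)%N).

Let A := dmx (tri 0 b r) *m C.

Let uA : A \in unitmx. Proof. by rewrite unitmx_mul dmx_unit. Qed.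

Let tri_scale1 x y z : w *: dmx (tri x y z) = dmx (tri (x + 1) (y + 1) (z + 1)).
Proof. by rewrite -tri_scale expr1z. Qed.

Let wAE : w *: A = dmx (tri 1 (b%:Z + 1) (r%:Z + 1)) *m C.
Proof. by rewrite scalemxAl tri_scale1 add0r. Qed.

Let wCE k : w ^ k *: C = dmx (tri k k k) *m C.
Proof. by rewrite dmx_cst; congr (dmx _ *m _); apply/funext; exact: ord3. Qed.

Let wC1 : w *: C = w ^ 1 *: C. Proof. by rewrite expr1z. Qed.

(* In terms of the rows e0, e1, e2 of [C], where A = <e0, w^b e1, w^r e2>:
   up_nbr t   = <e0 + t w^b e1, w^(b+1) e1, w^r e2>,
   down_nbr t = <w e0, w^b e1 + t w^r e2, w^(r+1) e2>. *)
Definition up_nbr t := dmx (tri 0 (b%:Z + 1) r) *m elem C o0 o1 (t * w ^ b).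
Definition down_nbr t := dmx (tri 1 b (r%:Z + 1)) *m elem C o1 o2 (t * w ^ (r%:Z - b%:Z)).

Let vbXMr (m : int) t k : vb k t -> vb (m + k) (t * w ^ m).
Proof. by move=> tk; rewrite mulrC vb_scale ?wX_neq0 // val_wX addrC addKr. Qed.

Let up_coef t : vb 0 t -> vb 0 (t * w ^ b).
Proof. by move=> t0; apply: vbW (vbXMr b t0). Qed.

Let down_coef t : vb 0 t -> vb 0 (t * w ^ (r%:Z - b%:Z)).
Proof. by move=> t0; apply: vbW (vbXMr _ t0); lia. Qed.

(** Adding t w^b e1, which lies in A, to e0 preserves A, so A and its neighbour are diagonal in one
    basis. *)
Let A_up t : vb 0 t -> lat A = lat (dmx (tri 0 b r) *m elem C o0 o1 (t * w ^ b)).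
Proof.
move=> t0; rewrite /A -[in LHS](elem0 C o0 o1); apply/lat_elem_eqP => //.
by rewrite sub0r vbN /tri /= subr0 -[X in vb X _]addr0; exact: vbXMr.
Qed.

Let A_down t : vb 0 t ->
  lat A = lat (dmx (tri 0 b r) *m elem C o1 o2 (t * w ^ (r%:Z - b%:Z))).
Proof.
move=> t0; rewrite /A -[in LHS](elem0 C o1 o2); apply/lat_elem_eqP => //.
by rewrite sub0r vbN /tri /= -[X in vb X _]addr0; exact: vbXMr.
Qed.

Lemma up_nbrP t : vb 0 t -> (b < r)%N ->
  adj (cls A) (cls (up_nbr t)) /\ pos C0 r b.+1 (cls (up_nbr t)).
Proof.
move=> t0 b_lt_r; have uE s : elem C o0 o1 s \in unitmx by exact: elem_unit.
split; last first.
  exists (elem C o0 o1 (t * w ^ b)); split=> //; last first.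
    by rewrite /up_nbr (_ : b.+1%:Z = b%:Z + 1) //; lia.
  by rewrite lat_elem //; exact: up_coef.
rewrite (lat_eq_cls (A_up t0)); apply: adj_dmx => //.
- by apply: ord3; rewrite /tri /=; lia.
- by exists o1; rewrite /tri /=; lia.
- by exists o0.
Qed.

Lemma down_nbrP t : vb 0 t -> (0 < b)%N ->
  adj (cls A) (cls (down_nbr t)) /\ pos C0 r b.-1 (cls (down_nbr t)).
Proof.
move=> t0 b_gt0; have uE s : elem C o1 o2 s \in unitmx by exact: elem_unit.
split; last first.
  exists (elem C o1 o2 (t * w ^ (r%:Z - b%:Z))); split=> //; last by lia.
    by rewrite lat_elem //; exact: down_coef.
  rewrite -[RHS](@cls_scale _ w) ?w_neq0 //; last by rewrite unitmx_mul dmx_unit uE.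
  rewrite scalemxAl tri_scale1 add0r /down_nbr.
  by rewrite (_ : b.-1%:Z + 1 = b%:Z) //; lia.
rewrite (lat_eq_cls (A_down t0)); apply: adj_dmx => //.
- by apply: ord3; rewrite /tri /=; lia.
- by exists o0.
- by exists o1; rewrite /tri /=; lia.
Qed.

(** The lattice determines t w^b modulo w^(b+1), that is, t modulo w. The same count works for
    [down_nbr], so both families have the residue field as parameter set. *)
Lemma up_nbr_eqP t t' : vb 0 t -> vb 0 t' ->
  cls (up_nbr t) = cls (up_nbr t') <-> vb 1 (t - t').
Proof.
move=> t0 t'0; rewrite cls_elem_eqP ?up_coef // -mulrBl mulrC vb_scale ?wX_neq0 //.
by rewrite val_wX /tri /= subr0 addrAC subrr add0r.
Qed.

Lemma down_nbr_eqP t t' : vb 0 t -> vb 0 t' ->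
  cls (down_nbr t) = cls (down_nbr t') <-> vb 1 (t - t').
Proof.
move=> t0 t'0; rewrite cls_elem_eqP ?down_coef // -mulrBl mulrC vb_scale ?wX_neq0 //.
by rewrite val_wX /tri /= (_ : r%:Z + 1 - b%:Z - (r%:Z - b%:Z) = 1) //; lia.
Qed.

Section OneNeighbour.
Variable B : 'M[F]_3.
Hypotheses (uB : B \in unitmx) (lt1 : lat (w *: A) `<` lat B) (lt2 : lat B `<` lat A).

Let wAB : lat (w *: A) `<=` lat B. Proof. by case: lt1. Qed.

(** Here j is 0 or 1, and B / wA is a plane or a line. Comparing volumes, a plane with j = 0 raises
    b by one and a line with j = 1 lowers it by one. The two mixed cases, which would shift b by
    two, are excluded. *)
Lemma adj_pos_cases b' : pos C0 r b' (cls B) ->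
  (b' = b.+1 /\ [/\ ~ lat B `<=` lat (w *: C), lat (w ^ r *: C) `<=` lat B &
     vol B = vol A + 1]) \/
  (b = b'.+1 /\ exists C1 : 'M[F]_3, [/\ C1 \in unitmx, lat A = lat C1,
     lat B = lat (dmx (tri 0 1 1) *m C1) &
     [/\ lat B `<=` lat (w *: C), ~ lat (w ^ r *: C) `<=` lat B & vol B = vol A + 2]]).
Proof.
move=> p; have [j [j1 j2 j3]] := pos_bounds uC0 uB p.
have volA : vol A = vol C0 + b%:Z + r%:Z.
  rewrite /A vol_dmx // sum_tri (lat_eq_vol uC uC0 CC0).
  by move: (vol _) => y; lia.
have {}j1 m : lat B `<=` lat (w ^ m *: C) <-> m <= j.
  by rewrite (lat_eqZ _ CC0); exact: j1.
have {}j2 m : lat (w ^ m *: C) `<=` lat B <-> r%:Z + j <= m.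
  by rewrite (lat_eqZ _ CC0); exact: j2.
have AC : lat A `<=` lat (w ^ 0 *: C).
  by apply/lat_dmx_sub_cst => //; apply: ord3.
have j_ge0 : 0 <= j by apply/j1; apply: subset_trans AC; case: lt2.
have j_le1 : r%:Z + j <= r%:Z + 1.
  apply/j2; apply: subset_trans wAB; rewrite wAE wCE.
  by apply/lat_dmx_sub => //; apply: ord3; rewrite /tri /=; lia.
have [C1 [e [uC1 AC1 BC1]]] := adj_basis uA uB lt1 lt2.
have volB : vol B = vol A + e%:Z + 1.
  rewrite (lat_eq_vol uB _ BC1) ?unitmx_mul ?dmx_unit // vol_dmx // sum_tri.
  by rewrite (lat_eq_vol uA uC1 AC1); move: (vol _) => y; lia.
have wAC1 : lat (w *: A) = lat (w *: C1) by exact: lat_eqZ.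
have wrA : lat (w ^ r *: C) `<=` lat A.
  by rewrite wCE; apply/lat_dmx_sub => //; apply: ord3; rewrite /tri /=; lia.
have wrwC : lat (w ^ r *: C) `<=` lat (w *: C).
  rewrite wC1 !wCE.
  by apply/lat_dmx_sub => //; apply: ord3; rewrite /tri /=; lia.
case: e => [|] in BC1 volB *.
(* Otherwise B / wA is a line containing, hence spanned by, [w ^ r e2]: then
   B lies in wC, which contradicts [j = 0]. *)
- have j1' : j = 1.
    have [//|j0] : j = 1 \/ j = 0 by lia.
    exfalso; have BwC : lat B `<=` lat (w ^ 1 *: C); last by move/j1: BwC; lia.
    have wrB : lat (w ^ r *: C) `<=` lat B by apply/j2; lia.
    pose z : 'rV[F]_3 := (w ^ r *: delta_mx 0 o2) *m C.
    have zr : lat (w ^ r *: C) z.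
      rewrite wCE; apply/lat_dmxP => //; apply: ord3; rewrite !mxE /=.
      + by rewrite mulr0 vb0.
      + by rewrite mulr0 vb0.
      + by rewrite mulr1 vbE ?wX_neq0 // val_wX.
    have zA : ~ lat (w *: C1) z.
      rewrite -wAC1 wAE => /(lat_dmxP _ _ uC)/(_ o2); rewrite !mxE /= mulr1.
      by rewrite vbE ?wX_neq0 // val_wX /tri /=; lia.
    move=> x Bx.
    have [t t0] := line_span uC1 BC1 (wrB _ zr) zA Bx.
    rewrite -wAC1 expr1z => xtz.
    apply: (latBK (latZ t0 (wrwC _ zr))).
    move: xtz; apply: (_ : lat (w *: A) `<=` lat (w *: C)).
    by apply/lat_subZ; rewrite ?w_neq0 //; move: AC; rewrite expr0z scale1r.
  right; split.
    by move: j3; rewrite volB volA j1'; move: (vol _) => y; lia.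
  exists C1; split=> //; split.
  - by rewrite wC1; apply/j1; rewrite j1'.
  - by move/j2; rewrite j1'; lia.
  - by rewrite volB -addrA.
(* Otherwise the plane B / wA does not contain [e0], and writing y in w^r C as an
   element of B plus a multiple of [e0] shows that w^r C lies in B. *)
have j0' : j = 0.
  have [//|j1'] : j = 0 \/ j = 1 by lia.
  exfalso; have wrB : lat (w ^ r *: C) `<=` lat B; last by move/j2: wrB; lia.
  have BwC : lat B `<=` lat (w ^ 1 *: C) by apply/j1; lia.
  pose z : 'rV[F]_3 := delta_mx 0 o0 *m C.
  have zC1 : lat C1 z.
    rewrite -AC1; apply/lat_dmxP => //; apply: ord3; rewrite !mxE /= ?vb0 ?vb1 //.
  have zB : ~ lat B z.
    move=> /BwC; rewrite wCE => /(lat_dmxP _ _ uC)/(_ o0); rewrite !mxE /=.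
    by rewrite vbE ?oner_neq0 // val1.
  move=> y yr; have yC1 : lat C1 y by rewrite -AC1; exact: wrA.
  have [t t0 Byt] := plane_span uC1 BC1 zC1 zB yC1.
  apply: (latBK _ Byt); apply: wAB.
  have : lat (w ^ 1 *: C) (t *: z).
    have := latD (latN (BwC _ Byt)) (wrwC _ yr : lat (w ^ 1 *: C) y).
    by rewrite opprB subrK.
  rewrite wCE /z scalemxAl => /(lat_dmxP _ _ uC)/(_ o0); rewrite !mxE /= mulr1 => t1.
  rewrite wAE; apply/lat_dmxP => //; apply: ord3; rewrite !mxE /= ?mulr0 ?vb0 //.
  by rewrite mulr1.
left; split; first by move: j3; rewrite volB volA j0'; move: (vol _) => y; lia.
split.
- by rewrite wC1 => /j1; rewrite j0'.
- by apply/j2; rewrite j0' addr0.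
- by rewrite volB addr0.
Qed.

(** Since b > 0, a vector x of B outside wC has a unit first coordinate. Together with wA and w^r C
    it accounts for all generators of [up_nbr t], and the volumes agree. *)
Lemma up_nbr_surj : (0 < b)%N -> ~ lat B `<=` lat (w *: C) ->
    lat (w ^ r *: C) `<=` lat B -> vol B = vol A + 1 ->
  exists2 t, vb 0 t & lat B = lat (up_nbr t).
Proof.
move=> b_gt0 /existsNP[x /not_implyP[Bx xwC]] wrB volB.
have [c xE] := lat_coord x uC.
have Ac : lat A (c *m C) by rewrite -xE; case: lt2 => + _; exact.
have {Ac} cA k : vb (tri 0 b r k) (c 0 k) by exact: (iffLR (lat_dmxP _ _ uC) Ac).
have c0 : ~~ vb 1 (c 0 o0).
  apply/negP => c0; apply: xwC; rewrite xE wC1 wCE; apply/lat_dmxP => //.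
  by apply: ord3 => //; [apply: vbW (cA o1)|apply: vbW (cA o2)]; rewrite /tri /=; lia.
have nz : c 0 o0 != 0 by apply: contra c0 => /eqP ->; rewrite vb0.
have vc0 : v (c 0 o0) = 0.
  by have := cA o0; move: c0; rewrite !vbE // /tri /=; move: (v _) => y; lia.
(* The value for which x divided by its first coordinate has the same first two coordinates as e0 +
   t w^b e1. *)
pose t := c 0 o1 / c 0 o0 / w ^ b.
have t0 : vb 0 t.
  rewrite /t mulrC vb_scale ?invr_neq0 ?wX_neq0 // valV ?wX_neq0 // val_wX.
  rewrite mulrC vb_scale ?invr_neq0 // valV // vc0 opprK add0r oppr0 subr0.
  exact: (cA o1).
have uU : up_nbr t \in unitmx by rewrite /up_nbr unitmx_mul dmx_unit elem_unit.
have volU : vol B = vol (up_nbr t).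
  rewrite volB /A /up_nbr !vol_dmx ?elem_unit // !sum_tri.
  rewrite (lat_eq_vol (elem_unit _ _ _) uC (lat_elem _ _ _)) ?up_coef //.
  by clear; move: (vol _) => y; lia.
exists t => //; apply/esym/lat_volE => //.
(* The generators w e0 and w^(b+1) e1 come from wA, and w^r e2 from w^r C. *)
have sub1 y : lat (dmx (tri 1 (b%:Z + 1) r) *m C) y -> lat B y.
  have [d ->] := lat_coord y uC => /(lat_dmxP _ _ uC) hd.
  rewrite (_ : d = \row_k (if k == o2 then 0 else d 0 k) +
                   \row_k (if k == o2 then d 0 k else 0)); last first.
    by apply/rowP => k; rewrite !mxE; case: eqP; rewrite ?add0r ?addr0.
  rewrite mulmxDl; apply: latD.
    apply: wAB; rewrite wAE; apply/lat_dmxP => //.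
    by apply: ord3; rewrite !mxE /= ?vb0 //; [exact: (hd o0) | exact: (hd o1)].
  apply: wrB; rewrite wCE; apply/lat_dmxP => //.
  by apply: ord3; rewrite !mxE /= ?vb0 //; exact: (hd o2).
move=> y; have [d ->] := lat_coord y uC => /(lat_elemP uC (isT : o0 != o1) _ _ _) hd.
have d0 : vb 0 (d 0 o0) by have := hd o0; rewrite mul0r subr0.
have u0 : vb 0 (d 0 o0 / c 0 o0).
  by rewrite mulrC vb_scale ?invr_neq0 // valV // vc0.
apply: (latBK (latZ u0 Bx)); apply: sub1.
rewrite xE scalemxAl -mulmxBl; apply/lat_dmxP => //; apply: ord3; rewrite !mxE.
- by rewrite divfK // subrr vb0.
- have := hd o1; rewrite eqxx mul1r /t; congr vb; congr (_ - _).
  by field; rewrite nz wX_neq0.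
- apply: vbB; first by have := hd o2; rewrite mul0r subr0.
  by apply: vbMl => //; exact: (cA o2).
Qed.

(** B is spanned by wA and one vector z, so it suffices that [down_nbr t] contain both; equal
    volumes do the rest. *)
Lemma down_nbr_surj (C1 : 'M[F]_3) : (b < r)%N -> C1 \in unitmx ->
    lat A = lat C1 -> lat B = lat (dmx (tri 0 1 1) *m C1) ->
    lat B `<=` lat (w *: C) -> ~ lat (w ^ r *: C) `<=` lat B ->
    vol B = vol A + 2 ->
  exists2 t, vb 0 t & lat B = lat (down_nbr t).
Proof.
move=> b_lt_r; have b1_le_r : b%:Z + 1 <= r%:Z by lia.
move=> uC1 AC1 BC1 BwC nwrB volB.
have wAC1 : lat (w *: A) = lat (w *: C1) by exact: lat_eqZ.
pose z : 'rV[F]_3 := delta_mx 0 o0 *m C1.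
have Bz : lat B z.
  by rewrite BC1; apply/lat_dmxP => //; apply: ord3; rewrite !mxE /= ?vb0 ?vb1.
have zwA : ~ lat (w *: A) z.
  rewrite wAC1 -[w in w *: C1]expr1z dmx_cst => /(lat_dmxP _ _ uC1)/(_ o0).
  by rewrite !mxE /= vbE ?oner_neq0 // val1.
have [c zE] := lat_coord z uC.
have Az : lat A (c *m C) by rewrite -zE; case: lt2 => + _; exact.
have {Az} cA k : vb (tri 0 b r k) (c 0 k) by exact: (iffLR (lat_dmxP _ _ uC) Az).
have c0 : vb 1 (c 0 o0).
  by move: (BwC _ Bz); rewrite zE wC1 wCE => /(lat_dmxP _ _ uC)/(_ o0).
have wAcoord (d : 'rV[F]_3) : vb 1 (d 0 o0) -> vb (b%:Z + 1) (d 0 o1) ->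
    vb (r%:Z + 1) (d 0 o2) -> lat (w *: A) (d *m C).
  by move=> d0 d1 d2; rewrite wAE; apply/lat_dmxP => //; exact: ord3.
(* Otherwise z would be a unit multiple of w^r e2 modulo wA, and B would contain w^r C; this uses b
   < r. *)
have c1 : ~~ vb (b%:Z + 1) (c 0 o1).
  apply/negP => c1; apply: nwrB => y; have [d ->] := lat_coord y uC.
  rewrite wCE => /(lat_dmxP _ _ uC) hd.
  have c2 : ~~ vb (r%:Z + 1) (c 0 o2).
    by apply/negP => c2; apply: zwA; rewrite zE; exact: wAcoord.
  have nz : c 0 o2 != 0 by apply: contra c2 => /eqP ->; rewrite vb0.
  have vc2 : v (c 0 o2) = r.
    by have := cA o2; move: c2; rewrite !vbE // /tri /=; clear; move: (v _) => u; lia.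
  have u0 : vb 0 (d 0 o2 / c 0 o2).
    by rewrite mulrC vb_scale ?invr_neq0 // valV // vc2 opprK add0r; exact: (hd o2).
  apply: (latBK (latZ u0 Bz)); apply: wAB.
  rewrite zE scalemxAl -mulmxBl; apply: wAcoord; rewrite !mxE.
  - by apply: vbB; [exact: vbW (hd o0) | exact: vbMl].
  - by apply: vbB; [exact: vbW (hd o1) | exact: vbMl].
  - by rewrite divfK // subrr vb0.
have nz : c 0 o1 != 0 by apply: contra c1 => /eqP ->; rewrite vb0.
have vc1 : v (c 0 o1) = b.
  by have := cA o1; move: c1; rewrite !vbE // /tri /=; clear; move: (v _) => u; lia.
(* Chosen so that c_1 e1 + c_2 e2 is a multiple of w^b e1 + t w^r e2; the remaining coordinate of z
   is divisible by w. *)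
pose t := c 0 o2 / c 0 o1 / w ^ (r%:Z - b%:Z).
have t0 : vb 0 t.
  rewrite /t mulrC vb_scale ?invr_neq0 ?wX_neq0 // valV ?wX_neq0 // val_wX.
  rewrite mulrC vb_scale ?invr_neq0 // valV // vc1 !opprK add0r subrK.
  exact: (cA o2).
have uD : down_nbr t \in unitmx by rewrite /down_nbr unitmx_mul dmx_unit elem_unit.
have volD : vol (down_nbr t) = vol B.
  rewrite volB /A /down_nbr !vol_dmx ?elem_unit // !sum_tri.
  rewrite (lat_eq_vol (elem_unit _ _ _) uC (lat_elem _ _ _)) ?down_coef //.
  by clear; move: (vol _) => y; lia.
exists t => //; apply: lat_volE => //.
have zdn : lat (down_nbr t) z.
  rewrite zE; apply/lat_elemP => //; apply: ord3; rewrite ?mul0r ?subr0 //.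
    exact: (cA o1).
  rewrite eqxx mul1r (_ : _ - _ = 0) ?vb0 // /t.
  by field; rewrite nz wX_neq0.
have wAdn y : lat (w *: A) y -> lat (down_nbr t) y.
  have [d ->] := lat_coord y uC; rewrite wAE => /(lat_dmxP _ _ uC) hd.
  apply/lat_elemP => //; apply: ord3; rewrite ?mul0r ?subr0.
  - exact: (hd o0).
  - by apply: vbW (hd o1); rewrite lerDl.
  rewrite eqxx mul1r; apply: vbB; first exact: (hd o2).
  rewrite (_ : tri _ _ _ _ = r%:Z - b%:Z + (b%:Z + 1)); last by rewrite addrA subrK.
  apply: vbM; last exact: (hd o1).
  by rewrite -[X in vb X _]addr0; exact: vbXMr.
move=> x Bx; have zwC1 : ~ lat (w *: C1) z by rewrite -wAC1.
have [u u0 xu] := line_span uC1 BC1 Bz zwC1 Bx.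
by apply: (latBK (latZ u0 zdn)); apply: wAdn; rewrite wAC1.
Qed.

End OneNeighbour.

(** The change of level by one holds at every b, while the parametrisations are claimed only away
    from the end where the family is too small: at b = 0 for [up_nbr], at b = r for [down_nbr]. *)
Lemma nbr_cases Y b' : adj (cls A) Y -> pos C0 r b' Y ->
  (b' = b.+1 /\ ((0 < b)%N -> exists2 t, vb 0 t & Y = cls (up_nbr t))) \/
  (b = b'.+1 /\ ((b < r)%N -> exists2 t, vb 0 t & Y = cls (down_nbr t))).
Proof.
move=> /(adjP _ uA)[B [uB -> lt1 lt2]] p.
case: (adj_pos_cases uB lt1 lt2 p) => [[bE [h1 h2 h3]]|[bE [C1 [h1 h2 h3 [h4 h5 h6]]]]].
  left; split=> // b_gt0.
  by have [t t0 E] := up_nbr_surj uB lt1 lt2 b_gt0 h1 h2 h3; exists t; rewrite ?(lat_eq_cls E).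
right; split=> // b_lt_r.
have [t t0 E] := down_nbr_surj uB lt1 lt2 b_lt_r h1 h2 h3 h4 h5 h6.
by exists t; rewrite ?(lat_eq_cls E).
Qed.

End Neighbours.

(** * The random walk on a sphere *)

Section Sphere.
Variables (R : realType) (C0 : 'M[F]_3) (r : nat).
Hypotheses (uC0 : C0 \in unitmx) (r_gt0 : (0 < r)%N).

Let S := sphere adj (cls C0) r.
Let W := building_sphere R v (cls C0) r.
Let X (i : 'I_(size (fset_set S))) := tnth (in_tuple (fset_set S)) i.

Let X_inj : injective X.
Proof. by apply/tuple_uniqP; exact: fset_uniq. Qed.

Let X_S i : S (X i).
Proof.
have : X i \in fset_set S by exact: mem_tnth.
by rewrite in_fset_set ?inE //; exact: sphere_finite.
Qed.

Let X_surj Y b : pos C0 r b Y -> exists i, Y = X i.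
Proof.
move=> p; have : Y \in fset_set S.
  rewrite in_fset_set ?inE; last exact: sphere_finite.
  by apply/(at_distanceP uC0); exists b.
by case/(tnthP (in_tuple (fset_set S))) => i ->; exists i.
Qed.

Let WE i j : W i j = (`[< adj (X i) (X j) >])%:R.
Proof. by rewrite mxE. Qed.

Lemma building_sphere_ge0 i j : 0 <= W i j.
Proof. by rewrite WE ler0n. Qed.

Lemma building_sphere_sym : W^T = W.
Proof.
apply/matrixP => i j; rewrite mxE !WE; congr (_%:R); congr nat_of_bool.
by apply: asbool_equiv_eq; split; exact: adj_sym.
Qed.

Let up i b : pred 'I_(size (fset_set S)) :=
  fun j => `[< adj (X i) (X j) /\ pos C0 r b.+1 (X j) >].
Let down i b : pred 'I_(size (fset_set S)) :=
  fun j => `[< adj (X i) (X j) /\ pos C0 r b.-1 (X j) >].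

(** Neighbours above and below are matched when they come from a common t. The matching is injective
    both ways because on either side equality means congruence modulo w. *)
Let card_up_down i b : pos C0 r b (X i) -> (0 < b < r)%N -> #|up i b| = #|down i b|.
Proof.
move=> [C [uC CC0 XE br]] /andP[b_gt0 b_lt_r].
pose rho Y Z := exists t, [/\ vb 0 t, Y = cls (up_nbr C r b t) & Z = cls (down_nbr C r b t)].
have upP j : up i b j <-> exists2 t, vb 0 t & X j = cls (up_nbr C r b t).
  split=> [/asboolP[]|[t t0 jE]].
    rewrite XE => a p; case: (nbr_cases uC0 uC CC0 r_gt0 br a p) => [[_]|[e _]]; first exact.
    by move: e; lia.
  by apply/asboolP; rewrite XE jE; exact: up_nbrP.
have downP j : down i b j <-> exists2 t, vb 0 t & X j = cls (down_nbr C r b t).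
  split=> [/asboolP[]|[t t0 jE]].
    rewrite XE => a p; case: (nbr_cases uC0 uC CC0 r_gt0 br a p) => [[e _]|[_]]; last exact.
    by move: e; lia.
  by apply/asboolP; rewrite XE jE; exact: down_nbrP.
have up_ex t : vb 0 t -> exists2 j, up i b j & X j = cls (up_nbr C r b t).
  move=> t0; have [_ p] := up_nbrP uC0 uC CC0 r_gt0 br t0 b_lt_r.
  by have [j E] := X_surj p; exists j => //; apply/upP; exists t.
have down_ex t : vb 0 t -> exists2 j, down i b j & X j = cls (down_nbr C r b t).
  move=> t0; have [_ p] := down_nbrP uC0 uC CC0 r_gt0 br t0 b_gt0.
  by have [j E] := X_surj p; exists j => //; apply/downP; exists t.
apply/eqP; rewrite eqn_leq; apply/andP; split.
- apply: (leq_card_rel (rho := fun j k => rho (X j) (X k))) => [j /upP[t t0 jt]|].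
    by have [k kD kE] := down_ex _ t0; exists k => //; exists t.
  move=> j j' k _ _ [t [t0 jt kt]] [t' [t'0 jt' kt']]; apply: X_inj.
  rewrite jt jt'; apply/(up_nbr_eqP r b uC) => //; apply/(down_nbr_eqP uC0 uC r_gt0 br) => //.
  by rewrite -kt -kt'.
- apply: (leq_card_rel (rho := fun j k => rho (X k) (X j))) => [j /downP[t t0 jt]|].
    by have [k kD kE] := up_ex _ t0; exists k => //; exists t.
  move=> j j' k _ _ [t [t0 kt jt]] [t' [t'0 kt' jt']]; apply: X_inj.
  rewrite jt jt'; apply/(down_nbr_eqP uC0 uC r_gt0 br) => //; apply/(up_nbr_eqP r b uC) => //.
  by rewrite -kt -kt'.
Qed.

(** Used for h = 1, which gives the degree, and for the cosine. The factor (0 < b) discards the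
    truncated predecessor [b.-1] = 0 at b = 0. *)
Let walk_split i b (h : nat -> R) (lev : 'I_(size (fset_set S)) -> nat) :
    (forall j, pos C0 r (lev j) (X j)) -> lev i = b ->
  \sum_j W i j * h (lev j) = #|up i b|%:R * h b.+1 + #|down i b|%:R * h b.-1 * (0 < b)%N%:R.
Proof.
move=> levP levi; have p := levP i; rewrite levi in p.
have [C [uC CC0 XE br]] := p.
pose d j := down i b j && (0 < b)%N.
transitivity (\sum_j ((up i b j)%:R * h b.+1 + (d j)%:R * h b.-1)).
  apply: eq_bigr => j _; rewrite WE.
  have -> : up i b j = `[< adj (X i) (X j) >] && (lev j == b.+1).
    apply/asboolP/andP => [[a q]|[/asboolP a /eqP <-]] //.
    by split; [exact/asboolP | apply/eqP; have [] := pos_uniq uC0 (levP j) q].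
  have -> : d j = `[< adj (X i) (X j) >] && (b == (lev j).+1).
    apply/andP/andP => [[/asboolP[a q] b0]|[/asboolP a /eqP ->]].
      split; first exact/asboolP.
      by have [_ ->] := pos_uniq uC0 (levP j) q; rewrite prednK.
    by split=> //; apply/asboolP; split=> //; exact: levP.
  case: asboolP => [a|_]; last by rewrite !mul0r addr0.
  have := a; rewrite XE => a'.
  case: (nbr_cases uC0 uC CC0 r_gt0 br a' (levP j)) => [[-> _]|[-> _]] /=.
    by rewrite eqxx (_ : b == _ = false) ?mul0r ?addr0 //; lia.
  by rewrite eqxx (_ : _ == _.+2 = false) ?mul0r ?add0r //; lia.
rewrite big_split /= -!mulr_suml -!natr_sum; congr (_ * _ + _).
  by rewrite -sum1_card [in RHS]big_mkcond; congr (_%:R);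
    apply: eq_bigr => j _; rewrite unfold_in; case: (up i b j).
rewrite mulrAC; congr (_ * _).
have [b0|b0] := posnP b.
  by rewrite mulr0 big1 // => j _; rewrite /d b0 ltnn andbF.
rewrite mulr1 -sum1_card [in RHS]big_mkcond; congr (_%:R).
by apply: eq_bigr => j _; rewrite unfold_in /d b0 andbT -/(down i b j); case: (down i b j).
Qed.

(** A vertex of level 0 is included because the lifted cosine equals 1 there, so that it is a
    nonzero eigenfunction. *)
Lemma building_sphere_level :
  exists lev : 'I_(size (fset_set S)) -> nat,
    [/\ forall i, 0 < degree W i, exists i, lev i = 0%N &
     forall i, \sum_j W i j * cos (pi * (lev j)%:R / r%:R) =
       cos (pi / r%:R) * degree W i * cos (pi * (lev i)%:R / r%:R)].
Proof.
have /fin_all_exists[lev levP] i : exists b, pos C0 r b (X i).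
  exact/(at_distanceP uC0)/X_S.
exists lev; split.
- move=> i; have [C [uC CC0 XE br]] := levP i.
  have [j ij] : exists j, adj (X i) (X j).
    have [b_lt_r|r_le_b] := ltnP (lev i) r.
      have [a p] := up_nbrP uC0 uC CC0 r_gt0 br (vb0 0) b_lt_r.
      by have [j E] := X_surj p; exists j; rewrite XE -E.
    have [a p] := down_nbrP uC0 uC CC0 r_gt0 br (vb0 0) (leq_trans r_gt0 r_le_b).
    by have [j E] := X_surj p; exists j; rewrite XE -E.
  rewrite /degree (bigD1 j) //= WE asboolT // ltr_pwDl // sumr_ge0 // => k _.
  exact: building_sphere_ge0.
- have p0 : pos C0 r 0 (cls (dmx (tri 0 0%N r) *m C0)) by exists C0.
  have [i Ei] := X_surj p0; exists i; have := levP i; rewrite -Ei.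
  by move/(pos_uniq uC0)/(_ p0) => [].
move=> i; have [C [uC CC0 XE br]] := levP i.
pose g k : R := cos (pi * k%:R / r%:R).
have degE : degree W i = #|up i (lev i)|%:R + #|down i (lev i)|%:R * (0 < lev i)%N%:R.
  transitivity (\sum_j W i j * (fun=> 1) (lev j)).
    by apply: eq_bigr => j _; rewrite mulr1.
  by rewrite (@walk_split i (lev i) (fun=> 1) lev levP erefl) !mulr1.
rewrite -/(g (lev i)) degE; etransitivity.
  exact: (@walk_split i (lev i) g lev levP erefl).
have [g0 gr grec] : [/\ g 1%N = cos (pi / r%:R) * g 0%N,
    g r.-1 = cos (pi / r%:R) * g r &
    (0 < lev i)%N -> g (lev i).+1 + g (lev i).-1 = 2 * cos (pi / r%:R) * g (lev i)] :=
  cos_path_rec R (lev i) r_gt0.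
have [b0|b_gt0] := posnP (lev i).
  by rewrite b0 /= !mulr0 !addr0 g0; ring.
rewrite mulr1.
have [b_lt_r|r_le_b] := ltnP (lev i) r.
  rewrite (card_up_down (levP i)) ?b_gt0 // !mulr1 -mulrDr grec //; ring.
have br' : lev i = r by apply/eqP; rewrite eqn_leq br.
(* A position has b at most r, so nothing on the sphere lies above level r. *)
have -> : #|up i (lev i)| = 0%N.
  apply/eqP/pred0P => j; apply/asboolP => -[_ [C' [_ _ _]]]; lia.
by rewrite br' !mul0r !add0r !mulr1 gr; ring.
Qed.

End Sphere.

End Lattices.

(** * Second eigenvalues of spheres and of their power graphs *)

Section SphereSpectrum.
Variables (R : realType) (F : fieldType) (v : F -> int).
Hypothesis hF : nonarch_local_field v.
Variable v0 : set (set 'rV[F]_3).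
Hypothesis hv0 : building_vertex v v0.

Lemma building_sphere_eigenvalues (r : nat) (W := building_sphere R v v0 r) :
    (0 < r)%N ->
  [/\ W^T = W, forall i, 0 < degree W i, forall i j, 0 <= W i j,
    eigenvalue (normalized_adjmx W) 1 &
    eigenvalue (normalized_adjmx W) (cos (pi / r%:R))].
Proof.
move=> r0; rewrite /W; have [w hw] := val_uniformizer hF.
have /vertexP[C0 uC0 ->] := hv0.
have [lev [deg_gt0 [i0 lev0] fE]] := building_sphere_level hF hw R uC0 r0.
have symW := building_sphere_sym hF hw R C0 r.
split=> //.
- exact: building_sphere_ge0.
- apply: (normalized_adjmx_eigenvalue symW deg_gt0 (f := fun=> 1)).
    by move=> i; rewrite mulr1 mul1r; apply: eq_bigr => j _; rewrite mulr1.
  by exists i0; rewrite oner_neq0.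
- apply: (normalized_adjmx_eigenvalue symW deg_gt0 fE).
  by exists i0; rewrite lev0 mulr0 mul0r cos0 oner_neq0.
Qed.

Lemma lambda2_building_sphere (r : nat) : (0 < r)%N ->
  cos (pi / r%:R) <= lambda2 (building_sphere R v v0 r) <= 1.
Proof.
move=> r0; have [symW deg_gt0 W_ge0 eig1 eigc] := building_sphere_eigenvalues r0.
have [cl eigl] := second_eigenvalue_ge (normalized_adjmx_sym symW) eigc eig1
  (cos_pi_div_lt1 R r0).
by rewrite cl; exact: (normalized_adjmx_eigenvalue_le1 symW deg_gt0 W_ge0 eigl).
Qed.

(** For r >= 2 the cosine is nonnegative, so its r-th power stays below 1 and the two eigenvalues of
    the power are distinct. *)
Lemma lambda2_power_building_sphere (r : nat) : (2 <= r)%N ->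
  cos (pi / r%:R) ^+ r <= lambda2 (power_graph r (building_sphere R v v0 r)).
Proof.
move=> r2; have r0 : (0 < r)%N by exact: leq_trans r2.
have [symW deg_gt0 W_ge0 eig1 eigc] := building_sphere_eigenvalues r0.
rewrite /lambda2 normalized_adjmx_power_graph //.
have [] // := @second_eigenvalue_ge R _ (normalized_adjmx (building_sphere R v v0 r) ^+ r)
  (cos (pi / r%:R) ^+ r) 1.
- by rewrite trmx_exp normalized_adjmx_sym.
- exact: eigenvalue_expmx.
- by rewrite -(expr1n _ r); exact: eigenvalue_expmx.
by rewrite exprn_ilt1 ?cos_pi_div_ge0 ?cos_pi_div_lt1 // -lt0n.
Qed.

End SphereSpectrum.

Theorem proposition4p2 (R : realType) (F : fieldType) (v : F -> int)
  (hF : nonarch_local_field v)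
  (v0 : set (set 'rV[F]_3)) (hv0 : building_vertex v v0) :
  [/\ forall r : nat, (2 <= r)%N ->
        cos (2 * pi / r%:R) <= lambda2 (building_sphere R v v0 r),
      (fun r : nat => cos (2 * pi / r%:R) : R) =
        (fun r : nat => 1 - 2 * pi ^+ 2 / r%:R ^+ 2)
          +O_\oo (fun r : nat => (r%:R ^+ 4)^-1 : R),
      (fun r : nat => lambda2 (building_sphere R v v0 r) ^+ r) @ \oo --> (1 : R)
    & ~ expander_family
          (fun k : nat => power_graph k.+1 (building_sphere R v v0 k.+1))].
Proof.
split.
- move=> r r2; have r0 : (0 < r)%N by exact: leq_trans r2.
  have /andP[+ _] := lambda2_building_sphere R hF hv0 r0; apply: le_trans.
  have rR : 0 < r%:R :> R by rewrite ltr0n.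
  have r2R : 2 <= r%:R :> R by rewrite ler_nat.
  have pi0 := pi_gt0 R; have pir : 0 < pi / r%:R :> R by rewrite divr_gt0.
  (* For r >= 2 both angles lie in [0, pi], where the cosine decreases. *)
  have pi2r : 2 * pi / r%:R <= pi :> R by rewrite ler_pdivrMr // mulrC ler_pM2l.
  have e : 2 * pi / r%:R = 2 * (pi / r%:R) :> R by rewrite mulrA.
  by apply: ltW; rewrite ltr_cos ?in_itv /=; rewrite ?e in pi2r *; lra.
- exact: cos_expand_eqaddO.
- apply/cvgrPdist_le => e e0; near=> r.
  have r3 : (3 <= r)%N by near: r; exact: nbhs_infty_ge.
  have rR : 0 < r%:R :> R by rewrite ltr0n (leq_trans _ r3).
  have /andP[cl l1] := lambda2_building_sphere R hF hv0 (leq_trans (isT : (0 < 3)%N) r3).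
  have c0 := cos_pi_div_ge0 R (ltnW r3).
  have lr : cos (pi / r%:R) ^+ r <= lambda2 (building_sphere R v v0 r) ^+ r.
    by rewrite lerXn2r // nnegrE (le_trans c0 cl).
  have lr1 : lambda2 (building_sphere R v v0 r) ^+ r <= 1.
    by rewrite exprn_ile1 // (le_trans c0 cl).
  rewrite ger0_norm ?subr_ge0 // lerBlDr -lerBlDl; apply: le_trans lr.
  apply: le_trans (cos_pi_exp_ge R r3); rewrite lerD2l lerN2.
  rewrite ler_pdivrMr // [e * _]mulrC -ler_pdivrMr //.
  by near: r; exact: nbhs_infty_ger.
- move=> [e e0 le_e].
  have x0 : 0 <= pi ^+ 2 / 2 / e :> R by rewrite !divr_ge0 ?sqr_ge0 // ltW.
  (* With r > pi^2 / (2 e), the lower bound 1 - pi^2 / (2 r) exceeds 1 - e. *)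
  pose r := maxn 3 (Num.bound (pi ^+ 2 / 2 / e : R)).
  have r3 : (3 <= r)%N by exact: leq_maxl.
  have rR : 0 < r%:R :> R by rewrite ltr0n (leq_trans _ r3).
  have rx : pi ^+ 2 / 2 / e < r%:R.
    by apply: (lt_le_trans (archi_boundP x0)); rewrite ler_nat leq_maxr.
  (* The family is indexed by k with radius k + 1. *)
  have := le_e r.-1; rewrite prednK ?(leq_trans _ r3) // => le_r.
  have := le_trans (cos_pi_exp_ge R r3)
    (le_trans (lambda2_power_building_sphere R hF hv0 (ltnW r3)) le_r).
  rewrite lerD2l lerN2 ler_pdivlMr // [e * _]mulrC -ler_pdivlMr //.
  by move/(lt_le_trans rx); rewrite ltxx.
Unshelve. all: by end_near. Qed.
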